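(* Consider a recurrent $\mathrm{IFS}(T_1,\dots,T_k;\mathbb P^+)$ ($k\ge2$) of continuous maps $T_i\colon[0,1]\to[0,1]$. Suppose that the inverse Markov measure $\mathbb P^-$ is mixing and splits $\mathrm{IFS}(T_1,\dots,T_k)$ in some non-trivial closed interval $J\subset[0,1]$. Then $\mathrm{IFS}(T_1,\dots,T_k;\mathbb P^+)$ is asymptotically stable and $\varpi_*\mathbb P^-$ is the stationary measure of the Markov operator $\mathfrak S_{\mathbb P^+}$.
   Context: Let $X=I=[0,1]$, $\Sigma_k^+=\{1,\dots,k\}^{\mathbb N}$ with left shift $\sigma(\xi)_n=\xi_{n+1}$, and cylinders $[a_0\dots a_\ell]=\{\omega\in\Sigma_k^+:\omega_0=a_0,\dots,\omega_\ell=a_\ell\}$. The set of weakly hyperbolic sequences is $S_{\mathrm t}=\{\xi\in\Sigma_k^+ : \lim_{n\to\infty}\mathrm{diam}(T_{\xi_0}\circ\cdots\circ T_{\xi_n}(X))=0\}$, and the coding map $\pi\colon S_{\mathrm t}\to X$ is $\pi(\xi)=\lim_{n\to\infty}T_{\xi_0}\circ\cdots\circ T_{\xi_n}(p)$, independent of $p\in X$. Markov measures. A transition matrix is a $k\times k$ matrix $P=(p_{ij})$ with $p_{ij}\ge0$ and $\sum_jp_{ij}=1$ for every $i$. It is irreducible if for all $\ell,r$ some power $P^n$ has positive $(\ell,r)$ entry; it then has a unique stationary probability vector $\bar p=(p_1,\dots,p_k)$, $\bar pP=\bar p$. The associated Markov measure $\mathbb P^+$ is the Borel probability on $\Sigma_k^+$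 with $\mathbb P^+([a_0\dots a_\ell])=p_{a_0}p_{a_0a_1}\cdots p_{a_{\ell-1}a_\ell}$. A recurrent IFS $\mathrm{IFS}(T_1,\dots,T_k;\mathbb P^+)$ consists of the maps together with the Markov measure $\mathbb P^+$ of an irreducible transition matrix $P$. The inverse Markov measure $\mathbb P^-$ is the (Markov) measure on $\Sigma_k^+$ with $\mathbb P^-([a_0a_1\dots a_n])=\mathbb P^+([a_n\dots a_1a_0])$. A measure $\mu$ on $\Sigma_k^+$ is mixing if $\lim_{n\to\infty}\mu(\sigma^{-n}(A)\cap B)=\mu(A)\mu(B)$ for all Borel $A,B$. Splitting. For a Markov measure $\mathbb Q$ on $\Sigma_k^+$, a cylinder is admissible if it has positive $\mathbb Q$-measure. For a non-trivial closed interval $J\subset[0,1]$, $\mathbb Q$ splits the IFS in $J$ if: (a) $T_i(J)\subset J$ and $T_i|_J$ is injective for every $i\in\{1,\dots,k\}$; (b) there are admissible cylinders $[i_1\dots i_\ell]$, $[j_1\dots j_s]$ of $\mathbb Q$ with $i_1=j_1$ such that $T_{j_1}\circ\cdots\circ T_{j_s}(I)\cap T_{i_1}\circ\cdots\circ T_{i_\ell}(I)=\emptyset$ and $T_{j_1}\circ\cdots\circ T_{j_s}(I)\cup T_{i_1}\circ\cdots\circ T_{i_\ell}(I)\subset J$. Markov operator. Let $\widehat X=X\times\{1,\dots,k\}$ with the product topology, and $\mathcal M_1(\widehat X)$ the Borel probability measures on $\widehat X$ with the weak$*$ topology. For $\widehat B\subset\widehat X$ put $\widehat B_j=\{x\in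 X:(x,j)\in\widehat B\}$, and for $\widehat\mu\in\mathcal M_1(\widehat X)$ put $\mu_i(B)=\widehat\mu(B\times\{i\})$. The (generalised) Markov operator $\mathfrak S_{\mathbb P^+}\colon\mathcal M_1(\widehat X)\to\mathcal M_1(\widehat X)$ is $\mathfrak S_{\mathbb P^+}(\widehat\mu)(\widehat B)=\sum_{i,j}p_{ij}\,T_{j*}\mu_i(\widehat B_j)$, where $T_{j*}\mu_i(A)=\mu_i(T_j^{-1}(A))$. A stationary measure is a fixed point of $\mathfrak S_{\mathbb P^+}$. The recurrent IFS is asymptotically stable if there is a stationary measure $\widehat\nu$ with $\lim_{n\to\infty}\mathfrak S_{\mathbb P^+}^n(\widehat\mu)=\widehat\nu$ (weak$*$) for every $\widehat\mu\in\mathcal M_1(\widehat X)$. The generalised coding map is $\varpi\colon S_{\mathrm t}\to\widehat X$, $\varpi(\xi)=(\pi(\xi),\xi_0)$, and $\varpi_*\mathbb P^-$ is the Borel measure $\widehat B\mapsto\mathbb P^-(\varpi^{-1}(\widehat B))$ on $\widehat X$. *)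

(* Defs.v *)
From HB Require Import structures.
From mathcomp Require Import all_boot all_order all_algebra.
From mathcomp Require Import all_classical all_reals all_analysis.

Set Implicit Arguments.
Unset Strict Implicit.
Unset Printing Implicit Defensive.

Import Order.TTheory GRing.Theory Num.Theory.
Import numFieldNormedType.Exports.

Local Open Scope classical_set_scope.
Local Open Scope ring_scope.

Definition unit_interval (R : realType) : Type :=
  set_type (`[0%R, 1%R]%classic : set R).

Lemma unit_interval0 (R : realType) : (0 : R) \in (`[0%R, 1%R]%classic : set R).
Proof. by rewrite inE /= in_itv /= lexx ler01. Qed.

HB.instance Definition _ (R : realType) :=
  Topological.copy (unit_interval R) (set_type (`[0%R, 1%R]%classic : set R)).
HB.instance Definition _ (R : realType) :=
  isPointed.Build (unit_interval R) (exist _ 0 (unit_interval0 R)).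

Definition ucoord (R : realType) (x : unit_interval R) : R := set_val x.

Lemma ucoord_itv (R : realType) (x : unit_interval R) : 0 <= ucoord x <= 1.
Proof. by have := set_valP x; rewrite /= in_itv. Qed.

Lemma ucoord_inj (R : realType) : injective (@ucoord R).
Proof. by move=> x y /eq_sig_hprop; exact. Qed.

Lemma ucoord_continuous (R : realType) : continuous (@ucoord R).
Proof. exact: initial_continuous. Qed.

Lemma unit_interval_hausdorff (R : realType) : hausdorff_space (unit_interval R).
Proof.
move=> x y xy; apply: ucoord_inj; apply: (@Rhausdorff R) => A B Ax By.
have [z [Az Bz]] := xy _ _ (ucoord_continuous Ax) (ucoord_continuous By).
by exists (ucoord z).
Qed.

Lemma unit_interval_cvg (R : realType) (I : Type) (F : set_system I)
    (FF : Filter F) (f : I -> unit_interval R) (x : unit_interval R) :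
  ucoord (f i) @[i --> F] --> ucoord x -> f i @[i --> F] --> x.
Proof.
move=> fx U [_ [[V oV <-] /= Vx VU]].
by apply: (filterS (fun i => VU (f i))); apply: fx; exact: open_nbhs_nbhs.
Qed.

(* The alphabet has k.+1 letters, so that it is inhabited (measurable types   *)
(* are pointed); it carries the discrete topology.                            *)
Definition symbol (k : nat) : Type := 'I_k.+1.
HB.instance Definition _ (k : nat) := Finite.copy (symbol k) 'I_k.+1.
HB.instance Definition _ (k : nat) :=
  DiscreteTopology.copy (symbol k) (discrete_topology 'I_k.+1).
HB.instance Definition _ (k : nat) := isPointed.Build (symbol k) ord0.

Definition shift_space (k : nat) : Type :=
  prod_topology (fun _ : nat => symbol k).
HB.instance Definition _ (k : nat) := Pointed.on (shift_space k).
HB.instance Definition _ (k : nat) := Topological.on (shift_space k).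

Definition ext_space (R : realType) (k : nat) : Type :=
  (unit_interval R * symbol k)%type.
HB.instance Definition _ (R : realType) (k : nat) :=
  Topological.copy (ext_space R k) (unit_interval R * symbol k)%type.
HB.instance Definition _ (R : realType) (k : nat) :=
  isPointed.Build (ext_space R k) (point, point).

Definition borel (S : ptopologicalType) := g_sigma_algebraType (@open S).

Definition shift (k : nat) (w : shift_space k) : shift_space k :=
  fun n => w n.+1.

Definition cylinder (k : nat) (s : seq (symbol k)) : set (shift_space k) :=
  [set w | forall i, (i < size s)%N -> w i = nth ord0 s i].

Section markov_measures.
Variables (R : realType) (k : nat) (P : 'M[R]_k.+1).

Definition transition_matrix : Prop :=
  (forall i j, 0 <= P i j) /\ (forall i, \sum_j P i j = 1).

Definition irreducible_matrix : Prop :=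
  forall l r, exists n : nat, 0 < (P ^+ n.+1) l r.

Definition stationary_vector (p : 'rV[R]_k.+1) : Prop :=
  [/\ forall i, 0 <= p 0 i, \sum_i p 0 i = 1 & p *m P = p].

(* path_weight a [:: a_1; ...; a_l] = P a a_1 * ... * P a_(l-1) a_l *)
Fixpoint path_weight (a : symbol k) (s : seq (symbol k)) : R :=
  if s is b :: s' then P a b * path_weight b s' else 1.

Definition markov_measure (Q : probability (borel (shift_space k)) R) : Prop :=
  exists2 p : 'rV[R]_k.+1, stationary_vector p &
    forall a s, Q (cylinder (a :: s)) = (p 0 a * path_weight a s)%:E.

End markov_measures.

Section shift_measures.
Variables (R : realType) (k : nat).

Definition inverse_markov_measure
    (Qplus Qminus : probability (borel (shift_space k)) R) : Prop :=
  forall s : seq (symbol k), Qminus (cylinder s) = Qplus (cylinder (rev s)).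

Definition mixing (Q : probability (borel (shift_space k)) R) : Prop :=
  forall A B : set (borel (shift_space k)), measurable A -> measurable B ->
    Q ((iter n (@shift k) @^-1` A) `&` B) @[n --> \oo] --> (Q A * Q B)%E.

End shift_measures.

Section ifs.
Variables (R : realType) (k : nat).
Local Notation X := (unit_interval R).
Local Notation Xhat := (ext_space R k).
Variable T : symbol k -> X -> X.

(* word_map [:: a_0; ...; a_n] = T a_0 \o ... \o T a_n *)
Definition word_map (s : seq (symbol k)) : X -> X :=
  foldr (fun a f => T a \o f) id s.

Definition orbit_map (w : shift_space k) (n : nat) : X -> X :=
  word_map (mkseq w n.+1).

Definition diam (A : set X) : R :=
  sup [set d | exists x y : X, [/\ A x, A y & d = `|ucoord x - ucoord y|]].

Definition weakly_hyperbolic : set (shift_space k) :=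
  [set w | diam (range (orbit_map w n)) @[n --> \oo] --> (0 : R)].

(* Only meaningful on weakly_hyperbolic; see coding_mapP for the              *)
(* independence of the base point.                                            *)
Definition coding_map (w : shift_space k) : X :=
  lim (orbit_map w n point @[n --> \oo]).

Lemma le_diam (A : set X) x y : A x -> A y ->
  `|ucoord x - ucoord y| <= diam A.
Proof.
move=> Ax Ay; apply: ub_le_sup; last by exists x, y.
exists 1 => _ [u [v [_ _ ->]]]; rewrite ler_norml.
have /andP[u0 u1] := ucoord_itv u; have /andP[v0 v1] := ucoord_itv v.
rewrite lerBrDr lerBlDr (le_trans u1) ?lerDl// andbT (le_trans _ u0)//.
by rewrite addrC subr_le0.
Qed.

Lemma orbit_map_nested w m n p : (n <= m)%N ->
  exists q, orbit_map w m p = orbit_map w n q.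
Proof.
move=> nm; rewrite /orbit_map /word_map.
rewrite (_ : m.+1 = (n.+1 + (m - n))%N); last by rewrite addSn subnKC.
rewrite /mkseq iotaD map_cat foldr_cat.
set q := foldr _ id (map _ (iota (0 + _) _)).
have foldrE s (g : X -> X) x :
    foldr (fun a f => T a \o f) g s x = foldr (fun a f => T a \o f) id s (g x).
  by elim: s => //= a s ->.
by exists (q p); rewrite foldrE.
Qed.

Lemma coding_mapP (w : shift_space k) : weakly_hyperbolic w ->
  forall p, orbit_map w n p @[n --> \oo] --> coding_map w.
Proof.
move=> hw; pose u n := ucoord (orbit_map w n point).
have udist m n p : (n <= m)%N ->
    `|u n - ucoord (orbit_map w m p)| <= diam (range (orbit_map w n)).
  move=> nm; have [q ->] := orbit_map_nested w p nm.
  by apply: le_diam; [exists point|exists q].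
have cu : cvgn u.
  apply/cauchy_cvgP/cauchy_exP => e e0.
  have /cvgrPdist_lt/(_ _ e0) [N _ hN] := hw.
  exists (u N); exists N => // n /= Nn; rewrite /ball /=.
  apply: le_lt_trans (udist _ _ _ Nn) _.
  by have /= := hN N (leqnn N); rewrite sub0r normrN; exact/le_lt_trans/ler_norm.
have [l ul] := (cvg_ex _).1 cu.
have l01 : l \in (`[0, 1]%classic : set R).
  rewrite inE /= in_itv /=; apply/andP; split.
    rewrite -(cvg_lim _ ul)//; apply: limr_ge => //; apply: nearW => n.
    by case/andP: (ucoord_itv (orbit_map w n point)).
  rewrite -(cvg_lim _ ul)//; apply: limr_le => //; apply: nearW => n.
  by case/andP: (ucoord_itv (orbit_map w n point)).
pose x : X := exist _ l l01.
have Fx p : orbit_map w n p @[n --> \oo] --> x.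
  apply: unit_interval_cvg => /=.
  have d0 : (u n - ucoord (orbit_map w n p)) @[n --> \oo] --> (0 : R).
    apply/norm_cvg0P.
    apply: (@squeeze_cvgr _ _ _ _ (fun=> 0)
      (fun n => diam (range (orbit_map w n)))) => //; last exact: cvg_cst.
    by apply: nearW => n; rewrite /= normr_ge0 udist.
  rewrite (_ : (fun n => ucoord (orbit_map w n p)) =
      u \- (fun n => u n - ucoord (orbit_map w n p))).
    have -> : ucoord x = l - 0 by rewrite subr0.
    exact: cvgB ul d0.
  by apply/funext => n /=; rewrite subKr.
move=> p; rewrite /coding_map (cvg_lim _ (Fx point))//.
exact: unit_interval_hausdorff.
Qed.

Definition ext_coding_map (w : shift_space k) : Xhat := (coding_map w, w 0%N).

(* nu is the image measure B |-> Q (ext_coding_map^-1 B), where               *)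
(* ext_coding_map has domain weakly_hyperbolic.                               *)
Definition ext_coding_image (Q : probability (borel (shift_space k)) R)
    (nu : probability (borel Xhat) R) : Prop :=
  forall B : set (borel Xhat), measurable B ->
    let A : set (borel (shift_space k)) :=
      weakly_hyperbolic `&` ext_coding_map @^-1` B in
    measurable A /\ nu B = Q A.

Definition closed_subinterval (J : set X) : Prop :=
  exists a b : R, [/\ 0 <= a, a < b, b <= 1 &
    J = [set x | a <= ucoord x <= b]].

Definition splits_in (Q : probability (borel (shift_space k)) R) (J : set X)
    : Prop :=
  (forall i, T i @` J `<=` J /\ {in J &, injective (T i)}) /\
  exists (a : symbol k) (s t : seq (symbol k)),
    let I_ u := range (word_map (a :: u)) in
    [/\ (0 < Q (cylinder (a :: s)))%E, (0 < Q (cylinder (a :: t)))%E,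
        I_ t `&` I_ s = set0 & I_ t `|` I_ s `<=` J].

Section markov_operator.
Variable P : 'M[R]_k.+1.

Definition slice (B : set Xhat) (j : symbol k) : set X := [set x | B (x, j)].

Definition component (mu : set (borel Xhat) -> \bar R) (i : symbol k)
  (A : set X) : \bar R := mu (A `*` [set i]).

Definition markov_fun (mu : set (borel Xhat) -> \bar R) (B : set (borel Xhat))
    : \bar R :=
  (\sum_i \sum_j (P i j)%:E * component mu i (T j @^-1` slice B j))%E.

Hypotheses (hP : transition_matrix P) (hT : forall i, continuous (T i)).
Variable mu : probability (borel Xhat) R.

Let pre (i j : symbol k) (B : set Xhat) : set (borel Xhat) :=
  (T j @^-1` slice B j) `*` [set i].

Let measurable_pre i j (B : set (borel Xhat)) :
  measurable B -> measurable (pre i j B).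
Proof.
move=> mB.
pose g (x : Xhat) : Xhat := (T j x.1, j).
have cg : continuous g.
  move=> x; apply: (@cvg_pair _ _ _ (nbhs x) (nbhs (T j x.1)) (nbhs j)
    _ _ _ (fun y => T j y.1) (fun=> j)); last exact: cvg_cst.
  apply: (@continuous_comp Xhat X X fst (T j)); last exact: hT.
  exact: cvg_fst.
have mg : measurable_fun setT (g : borel Xhat -> borel Xhat).
  apply: (@measurability _ _ (borel Xhat) (borel Xhat) _ _ (@open Xhat)).
    by [].
  move=> _ [C oC <-].
  apply: sub_sigma_algebra; rewrite setTI.
  by move/continuousP : cg; exact.
have -> : pre i j B = (setT `&` g @^-1` B) `&` (snd @^-1` [set i]).
  by apply/seteqP; split => x [] => [? ?|[]]; repeat split.
apply: measurableI; first exact: mg.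
apply: sub_sigma_algebra.
have /continuousP : continuous (snd : Xhat -> symbol k) by move=> x; exact: cvg_snd.
by apply; exact: discrete_open.
Qed.

Let markov_fun0 : markov_fun mu set0 = 0%E.
Proof.
rewrite /markov_fun big1// => i _; rewrite big1// => j _.
rewrite /component [X in mu X](_ : _ = set0) ?measure0 ?mule0//.
by apply/seteqP; split => x [].
Qed.

Let P_ge0 i j : (0 <= (P i j)%:E)%E.
Proof. by rewrite lee_fin; case: hP => + _; exact. Qed.

Let markov_fun_ge0 B : (0 <= markov_fun mu B)%E.
Proof. by do 2 apply: sume_ge0 => ? _; exact: mule_ge0. Qed.

Let markov_fun_sigma_additive : semi_sigma_additive (markov_fun mu).
Proof.
move=> F mF tF mUF.
rewrite [X in X @ _ --> _](_ : _ = fun n => (\sum_i \sum_j (P i j)%:E *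
    \sum_(0 <= m < n) mu (pre i j (F m)))%E); last first.
  apply/funext => n; rewrite exchange_big; apply: eq_bigr => i _ /=.
  rewrite exchange_big; apply: eq_bigr => j _ /=.
  by rewrite ge0_sume_distrr.
apply: cvg_nnesum => i _.
  apply: nearW => n; apply: sume_ge0 => j _; apply: mule_ge0 => //.
  exact: sume_ge0.
apply: cvg_nnesum => j _.
  by apply: nearW => n; apply: mule_ge0 => //; exact: sume_ge0.
apply: cvgeZl => //.
have -> : component mu i (T j @^-1` slice (\bigcup_n F n) j) =
    mu (\bigcup_n pre i j (F n)).
  congr (mu _); apply/seteqP; split => x.
    by move=> [[n _ Fn] xi]; exists n.
  by move=> [n _ [Fn xi]]; split => //; exists n.
apply: measure_semi_sigma_additive.
- by move=> n; exact: measurable_pre.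
- move=> m n _ _ [x [[xm _] [xn _]]]; apply: tF => //.
  by exists (T j x.1, j).
- by apply: bigcup_measurable => n _; exact: measurable_pre.
Qed.

Let markov_funT : markov_fun mu setT = 1%E.
Proof.
transitivity (\sum_(i : symbol k) mu (setT `*` [set i]))%E.
  apply: eq_bigr => i _.
  transitivity (\sum_j (P i j)%:E * mu (setT `*` [set i]))%E.
    by apply: eq_bigr.
  rewrite -ge0_sume_distrl// sumEFin (_ : (\sum_j P i j) = 1) ?mul1e//.
  by case: hP.
have m_fiber (i : symbol k) :
    measurable ((setT : set X) `*` [set i] : set (borel Xhat)).
  by have := @measurable_pre i i setT measurableT.
rewrite -(probability_setT mu).
rewrite -(@measure_bigsetU_ord _ _ _ mu _ predT
  (fun i : symbol k => setT `*` [set i]))//.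
  congr (mu _); apply/seteqP; split => // x _.
  rewrite -bigcup_mkord_ord/=; exists (x.2 : 'I_k.+1) => //=.
  by split => //=; rewrite inord_val.
by move=> i j _ _ [x [[_ /= ->] [_ /= ->]]].
Qed.

HB.instance Definition _ := isMeasure.Build _ _ _ (markov_fun mu)
  markov_fun0 markov_fun_ge0 markov_fun_sigma_additive.
HB.instance Definition _ := Measure_isProbability.Build _ _ _ (markov_fun mu)
  markov_funT.

Definition markov_operator : probability (borel Xhat) R := markov_fun mu.

Lemma markov_operatorE B : markov_operator B = markov_fun mu B.
Proof. by []. Qed.

End markov_operator.
End ifs.

(* Measures are total functions on sets; values off the Borel sets are junk.  *)
Definition eq_on_borel (S : ptopologicalType) (R : realType)
    (mu nu : probability (borel S) R) : Prop :=
  forall B, measurable B -> mu B = nu B.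

(* Used for compact S only, where every continuous function is bounded. *)
Definition weak_star_cvg (S : ptopologicalType) (R : realType)
    (mu_ : nat -> probability (borel S) R) (mu : probability (borel S) R)
    : Prop :=
  forall f : S -> R, continuous f ->
    (\int[mu_ n]_x (f x)%:E)%E @[n --> \oo] --> (\int[mu]_x (f x)%:E)%E.

Section stability.
Variables (R : realType) (k : nat).
Variable T : symbol k -> unit_interval R -> unit_interval R.
Variable P : 'M[R]_k.+1.
Hypotheses (hP : transition_matrix P) (hT : forall i, continuous (T i)).

Definition stationary_measure (nu : probability (borel (ext_space R k)) R)
    : Prop := eq_on_borel (markov_operator hP hT nu) nu.

Definition asymptotically_stable : Prop :=
  exists2 nu, stationary_measure nu &
    forall mu, weak_star_cvg (fun n => iter n (markov_operator hP hT) mu) nu.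

End stability.

(* Main.v *)
Require Import Defs.
From HB Require Import structures.
From mathcomp Require Import all_boot all_order all_algebra.
From mathcomp Require Import all_classical all_reals all_analysis.
From mathcomp Require Import measurable_realfun.
From mathcomp Require Import ring lra.

Set Implicit Arguments.
Unset Strict Implicit.
Unset Printing Implicit Defensive.

Import Order.TTheory GRing.Theory Num.Theory.
Import numFieldNormedType.Exports.

Local Open Scope classical_set_scope.
Local Open Scope ring_scope.

(** A word of symbols is read as a composition of maps, its first letter being
    applied last.  The forward chain adds its letters at the outside of the
    composition, so its orbits need not converge.  At a fixed time, however,
    the stationary chain has the same law as the first letters of a sequence
    for the inverse measure, and such a sequence adds letters at the inside:
    the images are then nested and can shrink to a point, which is the value
    of the coding map.

    Contraction.  Fix a point [x].  The splitting condition supplies two words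
    with the same first letter and disjoint images inside [J]; by
    irreducibility every letter can be connected to that first letter.  All
    maps being injective on [J], whatever has been composed so far, [x] lies
    in the image of at most one of the two continuations.  Hence the words
    whose image contains [x] lose a fixed proportion of their mass in each
    block of bounded length, and their mass tends to zero
    ([hitting_mass_cvg0]).  An image is an interval; if its diameter is at
    least [e] it contains one of finitely many grid points, so the mass of the
    words with such an image tends to zero too ([diam_mass_cvg0]).  In
    particular almost every sequence for the inverse measure is weakly
    hyperbolic ([weakly_hyperbolic_ae]).

    Convergence.  Integrating a continuous [f] against an iterate of the
    Markov operator amounts to integrating the iterate of [f] under the dual
    operator [(U f) (x, i) = \sum_j P i j * f (T j x, j)]
    ([Rintegral_iter_markov]).  By contraction in mean and uniform continuity
    of [f], after many steps the iterate of [f] depends only on the symbol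
    ([iter_dual_oscillation]).  Mixing says that the transition probabilities
    converge to the stationary vector ([mixing_dual_cvg]), so further steps
    average the symbol out: the iterates converge uniformly to a constant
    ([iter_dual_cvg]).  The constant is found by averaging over a stationary
    starting symbol: the average is the integral, for the inverse measure, of
    [f] along the orbit approximating the coding map, and by dominated
    convergence it tends to the integral of [f] against the image of that
    measure under the extended coding map ([coding_measure_cvg]).

    Invariance and uniqueness follow from this convergence, because a Borel
    probability on the extended space is determined by the integrals of
    continuous functions ([eq_on_borel_continuous]). *)

(** * Sums over words *)

Section word_sums.
Variables (V : nmodType) (A : finType).
Implicit Types (F : seq A -> V) (m n : nat).

Lemma sum_word0 F : \sum_(w : 0.-tuple A) F w = F [::].
Proof.
rewrite (bigD1 [tuple])//= big1 ?addr0// => w /negP; case.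
by rewrite tuple0.
Qed.

Lemma sum_word_cons n F :
  \sum_(w : n.+1.-tuple A) F w = \sum_a \sum_(w : n.-tuple A) F (a :: w).
Proof.
rewrite pair_big/=.
rewrite (reindex (fun p : A * n.-tuple A => cons_tuple p.1 p.2))//=.
exists (fun w : n.+1.-tuple A => (thead w, behead_tuple w)).
  move=> [a w] _ /=; rewrite theadE; congr pair.
  exact: val_inj.
by move=> w _ /=; rewrite [RHS]tuple_eta; exact: val_inj.
Qed.

Lemma sum_word_rcons n F :
  \sum_(w : n.+1.-tuple A) F w = \sum_a \sum_(w : n.-tuple A) F (rcons w a).
Proof.
elim: n F => [|n ih] F.
  rewrite sum_word_cons; apply: eq_bigr => a _.
  by rewrite (sum_word0 (fun w => F (a :: w))) (sum_word0 (fun w => F (rcons w a))).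
rewrite sum_word_cons.
transitivity (\sum_a \sum_b \sum_(w : n.-tuple A) F (a :: rcons w b)).
  by apply: eq_bigr => a _; rewrite (ih (fun w => F (a :: w))).
rewrite exchange_big; apply: eq_bigr => b _ /=.
by rewrite (sum_word_cons _ (fun w => F (rcons w b))).
Qed.

Lemma sum_word_cat m n F :
  \sum_(w : (m + n).-tuple A) F w =
  \sum_(u : m.-tuple A) \sum_(v : n.-tuple A) F (u ++ v).
Proof.
elim: m F => [|m ih] F.
  by rewrite (sum_word0 (fun u => \sum_(v : n.-tuple A) F (u ++ v))).
rewrite (sum_word_cons _ (fun u => \sum_(v : n.-tuple A) F (u ++ v))).
rewrite addSn sum_word_cons; apply: eq_bigr => a _.
by rewrite (ih (fun w => F (a :: w))).
Qed.

End word_sums.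

Lemma word_map_cat (R : realType) k (T : symbol k -> unit_interval R -> unit_interval R)
  u v x : word_map T (u ++ v) x = word_map T u (word_map T v x).
Proof. by elim: u => //= a u ->. Qed.

Lemma word_map_rcons (R : realType) k (T : symbol k -> unit_interval R -> unit_interval R)
  u a x : word_map T (rcons u a) x = word_map T u (T a x).
Proof. by rewrite -cats1 word_map_cat. Qed.

Lemma path_weight_cat (R : realType) k (P : 'M[R]_k.+1) (a : symbol k) s t :
  path_weight P a (s ++ t) = path_weight P a s * path_weight P (last a s) t.
Proof. by elim: s a => [|b s ih] a /=; rewrite ?mul1r// ih mulrA. Qed.

(** * Masses of words for the inverse Markov measure *)

Section word_mass.
Variables (R : realType) (k : nat) (P : 'M[R]_k.+1) (p : 'rV[R]_k.+1).
Hypotheses (hP : transition_matrix P) (hp : stationary_vector P p).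
Implicit Types (w v : seq (symbol k)) (a b : symbol k).

(** The mass of the cylinder of [w] for the inverse Markov measure: the
    forward chain runs through [w] from its last letter to its first. *)
Definition word_mass w : R :=
  if rev w is a :: s then p 0 a * path_weight P a s else 1.

Lemma path_weight_ge0 a s : 0 <= path_weight P a s.
Proof. by elim: s a => //= b s ih a; rewrite mulr_ge0//; case: hP. Qed.

Lemma stationary_le1 a : p 0 a <= 1.
Proof.
case: hp => p0 <- _; rewrite (bigD1 a)//= lerDl.
by apply: sumr_ge0 => b _; exact: p0.
Qed.

Lemma word_mass_ge0 w : 0 <= word_mass w.
Proof.
rewrite /word_mass; case: (rev w) => // a s.
by rewrite mulr_ge0 ?path_weight_ge0//; case: hp.
Qed.

Lemma word_mass_rcons w a :
  word_mass (rcons w a) = p 0 a * path_weight P a (rev w).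
Proof. by rewrite /word_mass rev_rcons. Qed.

(** A letter appended to [w] is a letter that precedes it in the forward
    chain, so consistency of the masses is stationarity of [p]. *)
Lemma sum_word_mass_rcons w : \sum_a word_mass (rcons w a) = word_mass w.
Proof.
rewrite (eq_bigr _ (fun a _ => word_mass_rcons w a)).
case/lastP: w => [|w b].
  transitivity (\sum_a p 0 a); last by case: hp.
  by apply: eq_bigr => a _; rewrite /= mulr1.
rewrite word_mass_rcons rev_rcons /=.
transitivity ((\sum_a p 0 a * P a b) * path_weight P b (rev w)).
  by rewrite mulr_suml; apply: eq_bigr => a _; rewrite mulrA.
by congr (_ * _); case: hp => _ _ /rowP/(_ b); rewrite mxE.
Qed.

Lemma sum_word_mass_cat w n : \sum_(v : n.-tuple (symbol k)) word_mass (w ++ v) = word_mass w.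
Proof.
elim: n => [|n ih].
  by rewrite (sum_word0 (fun v => word_mass (w ++ v))) cats0.
rewrite (sum_word_rcons n (fun v => word_mass (w ++ v))) exchange_big /= -[RHS]ih.
apply: eq_bigr => v _; rewrite -sum_word_mass_rcons.
by apply: eq_bigr => a _; rewrite rcons_cat.
Qed.

Lemma sum_word_mass n : \sum_(v : n.-tuple (symbol k)) word_mass v = 1.
Proof. by rewrite (sum_word_mass_cat [::]). Qed.

Lemma word_mass_cat_le w v : word_mass (w ++ v) <= word_mass w.
Proof.
rewrite -(sum_word_mass_cat w (size v)) (bigD1 (in_tuple v))//= lerDl.
by apply: sumr_ge0 => u _; exact: word_mass_ge0.
Qed.

(** Markov property of the inverse chain: given the letter [b], past and
    future are independent.  The factor [p 0 b] is the mass of the one-letter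
    word, moved to the left to avoid a division. *)
Lemma word_mass_markov w b v :
  p 0 b * word_mass (rcons w b ++ v) = word_mass (rcons w b) * word_mass (b :: v).
Proof.
case/lastP: v => [|v a].
  by rewrite cats0 mulrC; congr (_ * _); rewrite (word_mass_rcons [::]) mulr1.
rewrite -rcons_cat -rcons_cons !word_mass_rcons rev_cat rev_cons rev_rcons.
by rewrite -cats1 !path_weight_cat /= mulr1; ring.
Qed.

End word_mass.

(** * Words whose image contains a given point *)

(** Some letter has positive mass, and a power of [P], which also fixes [p],
    leads from it to any other letter. *)
Lemma stationary_gt0 (R : realType) k (P : 'M[R]_k.+1) (p : 'rV[R]_k.+1) :
  transition_matrix P -> irreducible_matrix P -> stationary_vector P p ->
  forall a, 0 < p 0 a.
Proof.
move=> [P0 _] irr [p0 p1 pP] r.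
have [l pl] : exists l, 0 < p 0 l.
  apply/not_existsP => pN0; move: p1; rewrite big1 => [/eqP|l _].
    by rewrite eq_sym oner_eq0.
  by apply: le_anti; rewrite p0 andbT leNgt; apply/negP/pN0.
have [n Pn] := irr l r.
have pPn m : p *m P ^+ m = p.
  by elim: m => [|m ih]; rewrite ?mulmx1// exprS -mulmxE mulmxA pP.
have Pn0 m i j : 0 <= (P ^+ m) i j.
  elim: m i j => [|m ih] i j; first by rewrite expr0 mxE ler0n.
  by rewrite exprS mxE; apply: sumr_ge0 => h _; rewrite mulr_ge0.
rewrite -(pPn n.+1) mxE (bigD1 l)//= ltr_pwDl ?mulr_gt0//.
by apply: sumr_ge0 => i _; rewrite mulr_ge0.
Qed.

Lemma irreducible_path (R : realType) k (P : 'M[R]_k.+1) :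
  transition_matrix P -> irreducible_matrix P ->
  forall a b, exists s, 0 < path_weight P a (rcons s b).
Proof.
move=> hP irr a b; have [n] := irr a b.
have [P0 _] := hP.
elim: n a => [|n ih] a; first by rewrite expr1; exists [::]; rewrite /= mulr1.
rewrite exprS mxE => sum_gt0.
have [c] : exists c, 0 < P a c * (P ^+ n.+1) c b.
  apply/not_existsP => Pc; move: sum_gt0; rewrite ltNge => /negP; apply.
  by apply: sumr_le0 => c _; rewrite leNgt; apply/negP/Pc.
have := P0 a c; rewrite le_eqVlt => /predU1P[<-|Pac]; first by rewrite mul0r ltxx.
rewrite pmulr_rgt0// => /ih[s cs]; exists (c :: s) => /=.
by rewrite mulr_gt0.
Qed.

Section hitting_words.
Variables (R : realType) (k : nat).
Local Notation X := (unit_interval R).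
Variable T : symbol k -> X -> X.
Implicit Types (x : X) (w u v : seq (symbol k)).

Definition hits x w : bool := `[< range (word_map T w) x >].

Lemma hits_catl x w v : hits x (w ++ v) -> hits x w.
Proof.
move=> /asboolP[y _ <-]; apply/asboolP; exists (word_map T v y) => //.
by rewrite word_map_cat.
Qed.

Lemma word_map_stable (J : set X) : (forall i, T i @` J `<=` J) ->
  forall w x, J x -> J (word_map T w x).
Proof. by move=> TJ; elim=> //= a w ih x /ih Jx; apply: (TJ a); exists (word_map T w x). Qed.

Lemma word_map_inj (J : set X) : (forall i, T i @` J `<=` J) ->
  (forall i, {in J &, injective (T i)}) ->
  forall w, {in J &, injective (word_map T w)}.
Proof.
move=> TJ Tinj; elim=> [//|a w ih] x y Jx Jy /= /Tinj wxy.
by apply: ih => //; apply: wxy; rewrite inE; apply: word_map_stable => //; rewrite -inE.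
Qed.

(** All maps are injective on the invariant set [J], so a composition applied
    to two disjoint subsets of [J] keeps them disjoint. *)
Lemma hits_disjoint (J : set X) u v : (forall i, T i @` J `<=` J) ->
  (forall i, {in J &, injective (T i)}) ->
  range (word_map T u) `&` range (word_map T v) = set0 ->
  range (word_map T u) `|` range (word_map T v) `<=` J ->
  forall x w, ~~ (hits x (w ++ u) && hits x (w ++ v)).
Proof.
move=> TJ Tinj uv0 uvJ x w; apply/negP => /andP[/asboolP[y _] + /asboolP[z _]].
rewrite !word_map_cat => <- /(word_map_inj TJ Tinj) wyz.
have Ju : J (word_map T u y) by apply: uvJ; left; exists y.
have Jv : J (word_map T v z) by apply: uvJ; right; exists z.
suff : (range (word_map T u) `&` range (word_map T v)) (word_map T u y) by rewrite uv0.
by split; [exists y|exists z => //; apply: wyz; rewrite inE].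
Qed.

Variables (P : 'M[R]_k.+1) (p : 'rV[R]_k.+1).
Hypotheses (hP : transition_matrix P) (hp : stationary_vector P p).
Local Notation mass := (word_mass P p).

Definition hitting_mass x n : R :=
  \sum_(w : n.-tuple (symbol k)) mass w * (hits x w)%:R.

Lemma hitting_mass_ge0 x n : 0 <= hitting_mass x n.
Proof. by apply: sumr_ge0 => w _; rewrite mulr_ge0 ?ler0n ?word_mass_ge0. Qed.

Lemma hitting_extension_le x w n :
  \sum_(v : n.-tuple (symbol k)) mass (w ++ v) * (hits x (w ++ v))%:R <=
  mass w * (hits x w)%:R.
Proof.
rewrite -(sum_word_mass_cat hp w n) mulr_suml; apply: ler_sum => v _.
apply: ler_wpM2l; first exact: word_mass_ge0.
by rewrite ler_nat; case: (boolP (hits x (w ++ v))) => // /hits_catl ->.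
Qed.

Lemma hitting_mass_nonincr x : nonincreasing_seq (hitting_mass x).
Proof.
move=> m n mn; rewrite -(subnKC mn) /hitting_mass.
rewrite (sum_word_cat m (n - m) (fun w => mass w * (hits x w)%:R)).
by apply: ler_sum => w _; exact: hitting_extension_le.
Qed.

(** No extension of [w ++ v] hits [x] either, so at most the mass outside the
    cylinder of [w ++ v] survives. *)
Lemma missing_extension_loss x w v n : (size v <= n)%N -> ~~ hits x (w ++ v) ->
  \sum_(u : n.-tuple (symbol k)) mass (w ++ u) * (hits x (w ++ u))%:R <=
  mass w - mass (w ++ v).
Proof.
move=> vn xNwv; rewrite -(subnKC vn).
rewrite (sum_word_cat (size v) (n - size v)
  (fun u => mass (w ++ u) * (hits x (w ++ u))%:R)).
rewrite -(sum_word_mass_cat hp w (size v)).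
rewrite (bigD1 (in_tuple v))//= [in leRHS](bigD1 (in_tuple v))//= addrAC subrr add0r.
rewrite [X in X + _](_ : _ = 0) ?add0r.
  apply: ler_sum => u _.
  under eq_bigr do rewrite catA.
  apply: (le_trans (hitting_extension_le _ _ _)).
  by rewrite ler_piMr ?word_mass_ge0// lern1 leq_b1.
rewrite big1// => u _; rewrite catA.
by case: (boolP (hits x _)) => [/hits_catl|]; [rewrite (negPf xNwv)|rewrite mulr0].
Qed.

Hypothesis p_gt0 : forall a, 0 < p 0 a.

(** A forward path from [a] to [b], read backwards, leads the inverse chain
    from [b] to [a], after which any admissible word starting with [a] may
    follow. *)
Lemma word_mass_connect a b d s :
  0 < path_weight P a (rcons d b) -> 0 < mass (a :: s) ->
  0 < mass (b :: rev d ++ a :: s).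
Proof.
move=> dab mas; rewrite -(pmulr_rgt0 _ (p_gt0 a)).
rewrite -cat1s catA -cat_rcons cat1s word_mass_markov word_mass_rcons.
by rewrite !mulr_gt0//= rev_cons revK.
Qed.

(** The conditional probability of the continuation [v] depends on the last
    letter [b] only; dividing by [p 0 b <= 1] can only increase it.  This
    makes the loss of mass uniform over all words. *)
Lemma word_mass_cat_ge w b v :
  mass (rcons w b) * mass (b :: v) <= mass (rcons w b ++ v).
Proof.
rewrite -word_mass_markov ler_piMl ?word_mass_ge0//.
exact: (stationary_le1 hp).
Qed.

(** Each last letter admits two continuations of which a given point hits at
    most one, so a fixed proportion of the mass is lost after [L] letters. *)
Lemma hitting_mass_contraction :
  (forall b, exists uv : seq (symbol k) * seq (symbol k),
    [/\ 0 < mass (b :: uv.1), 0 < mass (b :: uv.2) &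
      forall x w, ~~ (hits x (w ++ uv.1) && hits x (w ++ uv.2))]) ->
  exists L (d : R), 0 < d /\
    forall x n, hitting_mass x (n.+1 + L) <= (1 - d) * hitting_mass x n.+1.
Proof.
move=> /choice[f fP].
pose L := (\max_b (size (f b).1 + size (f b).2))%N.
pose d := \big[Num.min/1]_b Num.min (mass (b :: (f b).1)) (mass (b :: (f b).2)).
have d_le b : d <= mass (b :: (f b).1) /\ d <= mass (b :: (f b).2).
  suff : d <= Num.min (mass (b :: (f b).1)) (mass (b :: (f b).2)).
    by rewrite le_min => /andP.
  exact: bigmin_le_cond.
exists L, d; split.
  by apply: lt_bigmin => // b _; case: (fP b) => ? ? _; rewrite lt_min; apply/andP.
move=> x n.
rewrite /hitting_mass (sum_word_cat n.+1 L (fun w => mass w * (hits x w)%:R)) mulr_sumr.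
apply: ler_sum => w _; have [xw|xNw] := boolP (hits x w); last first.
  by apply: (le_trans (hitting_extension_le _ _ _)); rewrite (negPf xNw) !mulr0.
have [w' [b wE]] : exists w' b, w = rcons w' b :> seq _.
  by case/tupleP: w {xw} => a w; exists (belast a w), (last a w); exact: lastI.
have [v [vL mv xNv]] : exists v, [/\ (size v <= L)%N, d <= mass (b :: v) & ~~ hits x (w ++ v)].
  have fL : (size (f b).1 + size (f b).2 <= L)%N.
    by rewrite /L; apply: (leq_bigmax b).
  have [d1 d2] := d_le b; have [_ _ /(_ x w)] := fP b.
  rewrite negb_and => /orP[] Nv.
    by exists (f b).1; split => //; exact: leq_trans (leq_addr _ _) fL.
  by exists (f b).2; split => //; exact: leq_trans (leq_addl _ _) fL.
(* [v] is the continuation, out of the two, whose image misses [x] *)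
apply: (le_trans (missing_extension_loss vL xNv)).
rewrite mulr1 mulrBl mul1r lerB//.
rewrite wE; apply: le_trans (word_mass_cat_ge _ _ _).
by rewrite mulrC ler_wpM2l ?word_mass_ge0.
Qed.

(** The limit [e] of the nonincreasing sequence satisfies
    [e <= (1 - d) * e] with [0 < d]. *)
Lemma hitting_mass_cvg0 :
  (forall b, exists uv : seq (symbol k) * seq (symbol k),
    [/\ 0 < mass (b :: uv.1), 0 < mass (b :: uv.2) &
      forall x w, ~~ (hits x (w ++ uv.1) && hits x (w ++ uv.2))]) ->
  forall x, hitting_mass x n @[n --> \oo] --> 0.
Proof.
move=> /hitting_mass_contraction[L [d [d0 contr]]] x.
have cvgA : cvgn (hitting_mass x).
  apply: nonincreasing_is_cvgn; first exact: hitting_mass_nonincr.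
  by exists 0 => _ [n _ <-]; exact: hitting_mass_ge0.
have [e Ae] : exists e : R, hitting_mass x n @[n --> \oo] --> e := (cvg_ex _).1 cvgA.
have Ae1 : hitting_mass x n.+1 @[n --> \oo] --> e by rewrite (cvg_shiftS (hitting_mass x)).
have AeL : hitting_mass x (n.+1 + L)%N @[n --> \oo] --> e.
  rewrite (_ : (fun n => _) = (fun n => hitting_mass x (n + L.+1)%N)); first by rewrite (cvg_shiftn L.+1 (hitting_mass x)).
  by apply/funext => n; rewrite addSnnS.
have e_le : e <= (1 - d) * e.
  rewrite -subr_ge0; apply: (cvgr_to_ge (cvgB (cvgMl_tmp (a := 1 - d) Ae1) AeL)).
  by apply: nearW => n /=; rewrite subr_ge0.
have e_ge0 : 0 <= e.
  by rewrite -(cvg_lim _ Ae)//; apply: limr_ge => //; apply: nearW => n; exact: hitting_mass_ge0.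
suff <- : e = 0 by [].
apply: le_anti; rewrite e_ge0 andbT -(pmulr_rle0 _ d0).
by move: e_le; rewrite mulrBl mul1r lerBrDr gerDl.
Qed.

End hitting_words.

(** * The extended phase space *)

Section unit_interval_facts.
Variable R : realType.
Local Notation X := (unit_interval R).
Implicit Types (x y : X) (r : R).

Lemma clamp_itv r : Num.max 0 (Num.min r 1) \in (`[0%R, 1%R]%classic : set R).
Proof. by rewrite inE /= in_itv /= le_max lexx ge_max ler01 ge_min lexx orbT. Qed.

(** A retraction of the line onto the interval, which lets results about
    functions on the line be applied on the interval. *)
Definition clamp r : X := exist _ (Num.max 0 (Num.min r 1)) (clamp_itv r).

Lemma clamp_id r : 0 <= r <= 1 -> ucoord (clamp r) = r.
Proof. by move=> /andP[r0 r1]; rewrite -[LHS]/(Num.max 0 (Num.min r 1)) (min_idPl r1) (max_idPr r0). Qed.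

Lemma ucoordK x : clamp (ucoord x) = x.
Proof. by apply: ucoord_inj; rewrite clamp_id// ucoord_itv. Qed.

Lemma clamp_continuous : continuous clamp.
Proof.
move=> r; apply: unit_interval_cvg.
apply: (@continuous_max R R (fun=> 0) (fun r => Num.min r 1)); first exact: cvg_cst.
apply: (@continuous_min R R id (fun=> 1)); first exact: cvg_id.
exact: cvg_cst.
Qed.

(** The function is extended to the line by [clamp]. *)
Lemma continuous_image_interval (f : X -> X) x y r : continuous f ->
  ucoord (f x) <= r <= ucoord (f y) -> exists z, ucoord (f z) = r.
Proof.
move=> cf; pose g s := ucoord (f (clamp s)).
have cg A : {within A, continuous g}.
  apply: continuous_subspaceT => s.
  apply: (@continuous_comp R X R (f \o clamp) (@ucoord R)); last exact: ucoord_continuous.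
  by apply: (@continuous_comp R X X clamp f); [exact: clamp_continuous|exact: cf].
have gE z : g (ucoord z) = ucoord (f z) by rewrite /g ucoordK.
rewrite -!gE => /andP[xr ry]; have [xy|/ltW yx] := leP (ucoord x) (ucoord y).
  have [|c _ <-] := IVT xy (cg _) (v := r); last by exists (clamp c).
  by rewrite ge_min le_max xr ry orbT.
have [|c _ <-] := IVT yx (cg _) (v := r); last by exists (clamp c).
by rewrite ge_min le_max xr ry orbT.
Qed.

Lemma unit_interval_compact : compact [set: X].
Proof.
have -> : [set: X] = clamp @` `[0, 1].
  apply/seteqP; split => // x _; exists (ucoord x); last exact: ucoordK.
  by rewrite /= in_itv /= ucoord_itv.
apply: continuous_compact; last exact: segment_compact.
exact/continuous_subspaceT/clamp_continuous.
Qed.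

Lemma diam_ge0 (A : set X) : 0 <= diam A.
Proof.
have [[x Ax]|A0] := pselect (exists x, A x).
  by apply: le_trans (le_diam Ax Ax).
rewrite /diam (_ : [set d | _] = set0) ?sup0//.
by apply/seteqP; split=> // d [x [y [Ax _ _]]]; apply: A0; exists x.
Qed.

Lemma diam_le_subset (A B : set X) : A !=set0 -> A `<=` B -> diam A <= diam B.
Proof.
move=> [x Ax] AB; apply: ge_sup; first by exists `|ucoord x - ucoord x|, x, x.
by move=> _ [y [z [/AB By /AB Bz ->]]]; exact: le_diam.
Qed.

Lemma diam_gtP (A : set X) r : A !=set0 -> r < diam A ->
  exists x y, [/\ A x, A y & r < ucoord y - ucoord x].
Proof.
move=> [x0 Ax0] rA.
have hasA : has_sup [set d | exists x y : X, [/\ A x, A y & d = `|ucoord x - ucoord y|]].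
  split; first by exists `|ucoord x0 - ucoord x0|, x0, x0.
  by exists (diam A) => _ [u [v [Au Av ->]]]; exact: le_diam.
have rA0 : 0 < diam A - r by rewrite subr_gt0.
have [_ [x [y [Ax Ay ->]]]] := sup_adherent rA0 hasA.
rewrite -/(diam A) subKr ltr_normr opprB => /orP[]; first by exists y, x.
by exists x, y.
Qed.

(** The first grid point after [r] is at most one mesh away from it. *)
Lemma grid_point (N : nat) r s : 0 <= r -> s <= 1 -> N.+1%:R^-1 < s - r ->
  exists j : 'I_N.+2, r <= j%:R / N.+1%:R <= s.
Proof.
move=> r0 s1 Nrs; have N0 : (0 : R) < N.+1%:R by rewrite ltr0n.
pose j := (Num.truncn (r * N.+1%:R)).+1.
have /andP[jr rj] : j.-1%:R <= r * N.+1%:R < j%:R.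
  by apply: truncn_itv; rewrite mulr_ge0// ltW.
have js : j%:R <= s * N.+1%:R.
  have : 1 < (s - r) * N.+1%:R by rewrite -ltr_pdivrMr// mul1r.
  have -> : j%:R = j.-1%:R + 1 :> R by rewrite natr1.
  by move: jr; rewrite mulrBl; lra.
have jN : (j < N.+2)%N.
  by rewrite ltnS -(ler_nat R); apply: le_trans js _; rewrite ler_piMl// ltW.
exists (Ordinal jN) => /=; rewrite ler_pdivlMr// (ltW rj)/=.
by rewrite ler_pdivrMr.
Qed.

End unit_interval_facts.

Section ext_space_facts.
Variables (R : realType) (k : nat).
Local Notation X := (unit_interval R).
Local Notation Xhat := (ext_space R k).

(** The symbols carry the discrete topology, so a small neighbourhood of a
    point stays within one fibre, where it is a ball. *)
Lemma nbhs_extP (x : X) (i : symbol k) (U : set Xhat) :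
  nbhs ((x, i) : Xhat) U <->
  exists2 r : R, 0 < r & forall y : X, `|ucoord x - ucoord y| < r -> U (y, i).
Proof.
split.
  move=> [[A B] /= [[_ [[V oV <-] /= Vx VA]] Bi] ABU].
  have /nbhs_ballP[r r0 rV] : nbhs (ucoord x) V by exact: open_nbhs_nbhs.
  exists r => // y xy; apply: ABU; split => /=; first by apply: VA; exact: rV.
  exact: nbhs_singleton Bi.
move=> [r r0 rU].
exists ([set y : X | `|ucoord x - ucoord y| < r], [set i]) => /=.
  split; last by apply: open_nbhs_nbhs; split => //; exact: discrete_open.
  have : nbhs (ucoord x) (ball (ucoord x) r) by exact: nbhsx_ballx.
  by move/(@ucoord_continuous R x).
by move=> [y j] [/= xy ->]; exact: rU.
Qed.

Lemma ext_continuousP (f : Xhat -> R) : continuous f <->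
  forall x i (e : R), 0 < e -> exists2 r : R, 0 < r &
    forall y, `|ucoord x - ucoord y| < r -> `|f (x, i) - f (y, i)| < e.
Proof.
split=> [cf x i e e0|cf [x i]].
  apply/(@nbhs_extP x i [set z : Xhat | `|f (x, i) - f z| < e]).
  by have /cvgrPdist_lt := cf (x, i); exact.
apply/cvgrPdist_lt => e e0.
exact/(@nbhs_extP x i [set z : Xhat | `|f (x, i) - f z| < e])/cf.
Qed.

Lemma ext_space_compact : compact [set: Xhat].
Proof.
rewrite (_ : [set: Xhat] = [set: X] `*` [set: symbol k]).
  apply: compact_setX; first exact: unit_interval_compact.
  by apply: finite_compact; exact: finite_finset.
by apply/seteqP; split.
Qed.

Lemma ext_continuous_bounded (f : Xhat -> R) : continuous f ->
  exists2 M, 0 < M & forall z, `|f z| <= M.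
Proof.
move=> cf; have /compact_bounded[M [_ fM]] : compact (f @` setT).
  by apply: continuous_compact; [exact: continuous_subspaceT|exact: ext_space_compact].
exists (`|M| + 1) => [|z]; first by rewrite ltr_wpDl.
by apply: fM; [rewrite ltr_pwDr// ler_norm|exists z].
Qed.

(** Heine's theorem, stated within the fibres because that is where orbits
    are compared. *)
Lemma ext_continuous_unif (f : Xhat -> R) (e : R) : continuous f -> 0 < e ->
  exists2 d : R, 0 < d & forall x y i,
    `|ucoord x - ucoord y| < d -> `|f (x, i) - f (y, i)| < e.
Proof.
move=> cf e0; have e20 : 0 < e / 2 by rewrite divr_gt0.
pose close (d : R) (z : Xhat) := forall y, `|ucoord z.1 - ucoord y| < d ->
  `|f z - f (y, z.2)| < e.
(* around [(x0, i0)] half of the radius given by continuity serves for all points *)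
have cover := (compact_near_coveringP _).1 ext_space_compact.
have [|d /= d0 closed] := (@cover R (0^'+) close _ _); last first.
  exists (d / 2) => [|x y i xy]; first by rewrite divr_gt0.
  apply: (closed (d / 2) _ _ (x, i)) => //=; last by rewrite divr_gt0.
  by rewrite sub0r normrN gtr0_norm ?divr_gt0// ltr_pdivrMr// ltr_pMr// ltr1n.
move=> [x0 i0] _; have /ext_continuousP/(_ x0 i0 _ e20)[r r0 fr] := cf.
have r20 : 0 < r / 2 by rewrite divr_gt0.
exists ([set z : Xhat | `|ucoord x0 - ucoord z.1| < r / 2 /\ z.2 = i0], [set d | d < r / 2]).
  split => /=; last exact: nbhs_right_lt.
  by apply/(@nbhs_extP x0 i0); exists (r / 2).
move=> [[x i] d] [/= [x0x ->] dr] y /= xy.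
rewrite (le_lt_trans (ler_distD (f (x0, i0)) _ _))// (splitr e) ltrD//.
  by rewrite distrC; apply: fr; lra.
by apply: fr; rewrite (le_lt_trans (ler_distD (ucoord x) _ _))//; lra.
Qed.

(** Distance to the complement of [U] within a fibre, capped at 1 so that it
    is positive when the fibre of [U] is everything.  It is a continuous function
    that is positive exactly on [U] when [U] is open, and serves to pass from
    continuous functions to open sets. *)
Definition depth (U : set Xhat) (z : Xhat) : R :=
  inf [set d | d = 1 \/ exists2 y, ~ U (y, z.2) & d = `|ucoord z.1 - ucoord y|].

Lemma depth_set_lb (U : set Xhat) (z : Xhat) : has_lbound
  [set d : R | d = 1 \/ exists2 y, ~ U (y, z.2) & d = `|ucoord z.1 - ucoord y|].
Proof. by exists 0 => d [->|[y _ ->]]. Qed.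

Lemma depth_ge0 (U : set Xhat) (z : Xhat) : 0 <= depth U z.
Proof.
apply: lb_le_inf; first by exists 1; left.
by move=> d [->|[y _ ->]].
Qed.

Lemma depth_notin (U : set Xhat) z : ~ U z -> depth U z = 0.
Proof.
case: z => x i NU; apply: le_anti; rewrite depth_ge0 andbT.
apply: (ge_inf (depth_set_lb U (x, i))); right; exists x => //=.
by rewrite subrr normr0.
Qed.

Lemma depth_gt0 (U : set Xhat) z : open U -> U z -> 0 < depth U z.
Proof.
case: z => x i oU Uz; have /nbhs_extP[r r0 rU] : nbhs ((x, i) : Xhat) U by exact: open_nbhs_nbhs.
apply: (@lt_le_trans _ _ (Num.min 1 r)); first by rewrite lt_min ltr01.
apply: lb_le_inf; first by exists 1; left.
move=> d [->|[y NU ->]]; rewrite ge_min ?lexx//=; apply/orP; right.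
by rewrite leNgt; apply/negP => /rU.
Qed.

Lemma depth_lip (U : set Xhat) x y i :
  depth U (x, i) <= depth U (y, i) + `|ucoord x - ucoord y|.
Proof.
rewrite -lerBlDr; apply: lb_le_inf; first by exists 1; left.
move=> d; rewrite lerBlDr => -[->|[u NU ->]] /=.
  rewrite -[leLHS]addr0 lerD//.
  by apply: (ge_inf (depth_set_lb U (x, i))); left.
apply: (@le_trans _ _ `|ucoord x - ucoord u|).
  by apply: (ge_inf (depth_set_lb U (x, i))); right; exists u.
by rewrite [leRHS]addrC ler_distD.
Qed.

Lemma depth_continuous (U : set Xhat) : continuous (depth U).
Proof.
apply/ext_continuousP => x i e e0; exists e => // y xy.
apply: le_lt_trans xy; rewrite ler_distl.
have := depth_lip U x y i; have := depth_lip U y x i.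
by rewrite (distrC (ucoord y)) => *; apply/andP; split; lra.
Qed.

End ext_space_facts.

(** * Contraction in mean *)

Lemma cvg_sumr (R : realType) (I : Type) (r : seq I) (U : Type)
    (F : set_system U) (f : I -> U -> R) (l : I -> R) : Filter F ->
  (forall i, f i x @[x --> F] --> l i) ->
  \sum_(i <- r) f i x @[x --> F] --> \sum_(i <- r) l i.
Proof. by move=> FF fl; apply: (cvg_big (@add_continuous R^o)) => i _; exact: fl. Qed.

Section contraction_in_mean.
Variables (R : realType) (k : nat).
Local Notation X := (unit_interval R).
Local Notation Xhat := (ext_space R k).
Variable T : symbol k -> X -> X.
Hypothesis hT : forall i, continuous (T i).
Variables (P : 'M[R]_k.+1) (p : 'rV[R]_k.+1).
Hypotheses (hP : transition_matrix P) (hp : stationary_vector P p).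
Local Notation mass := (word_mass P p).
Local Notation image_diam w := (diam (range (word_map T w))).

Lemma word_map_continuous w : continuous (word_map T w).
Proof.
elim: w => [|a w ih] x /=; first exact: cvg_id.
by apply: (@continuous_comp X X X (word_map T w) (T a)); [exact: ih|exact: hT].
Qed.

Lemma range_word_map_neq0 w : range (word_map T w) !=set0.
Proof. by exists (word_map T w point), point. Qed.

(** The image of the interval under a continuous map has no gaps. *)
Lemma large_image_hits_grid w (N : nat) : N.+1%:R^-1 < image_diam w ->
  exists j : 'I_N.+2, hits T (clamp (j%:R / N.+1%:R)) w.
Proof.
move=> /(diam_gtP (range_word_map_neq0 w))[_ [_ [[x _ <-] [y _ <-] Nxy]]].
have /andP[x0 _] := ucoord_itv (word_map T w x).
have /andP[_ y1] := ucoord_itv (word_map T w y).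
have [j /[dup] /andP[xj jy] xjy] := grid_point x0 y1 Nxy.
have [z zj] := continuous_image_interval (@word_map_continuous w) xjy.
by exists j; apply/asboolP; exists z => //; rewrite -zj ucoordK.
Qed.

Definition diam_mass (e : R) n : R :=
  \sum_(w : n.-tuple (symbol k)) mass w * (e <= image_diam w)%R%:R.

Lemma diam_mass_ge0 e n : 0 <= diam_mass e n.
Proof. by apply: sumr_ge0 => w _; rewrite mulr_ge0 ?ler0n ?word_mass_ge0. Qed.

Lemma diam_mass_le e n (N : nat) : N.+1%:R^-1 < e ->
  diam_mass e n <= \sum_(j < N.+2) hitting_mass T P p (clamp (j%:R / N.+1%:R)) n.
Proof.
move=> Ne; rewrite exchange_big; apply: ler_sum => w _ /=.
rewrite -mulr_sumr ler_wpM2l ?word_mass_ge0//.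
case: (lerP e (image_diam w)) => [ew|_]; last by apply: sumr_ge0 => j _; rewrite ler0n.
have [j wj] := large_image_hits_grid (lt_le_trans Ne ew).
by rewrite (bigD1 j)//= wj lerDl; apply: sumr_ge0 => i _; rewrite ler0n.
Qed.

(** An image that is not short contains one of finitely many grid points, and
    each of these is hit by words of vanishing mass. *)
Lemma diam_mass_cvg0 e : 0 < e ->
  (forall x, hitting_mass T P p x n @[n --> \oo] --> 0) ->
  diam_mass e n @[n --> \oo] --> 0.
Proof.
move=> e0 hit0.
have [N Ne] : exists N : nat, N.+1%:R^-1 < e.
  have [N _ /(_ N (leqnn N)) /= Ne] := near_infty_natSinv_lt (PosNum e0).
  by exists N.
apply: (@squeeze_cvgr _ _ _ _ (fun=> 0)
  (fun n => \sum_(j < N.+2) hitting_mass T P p (clamp (j%:R / N.+1%:R)) n)).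
- by apply: nearW => n; rewrite diam_mass_ge0 diam_mass_le.
- exact: cvg_cst.
- have := @cvg_sumr R _ (index_enum 'I_N.+2) _ \oo
    (fun j n => hitting_mass T P p (clamp (j%:R / N.+1%:R)) n) (fun=> 0) _ (fun j => hit0 _).
  by rewrite big1//; apply; exact: eventually_filter.
Qed.

(** * The dual operator *)

(** Integrating against the image of a measure under the Markov operator is
    integrating the image of the function under this operator. *)
Definition dual_operator (f : Xhat -> R) (z : Xhat) : R :=
  \sum_j P z.2 j * f (T j z.1, j).
Local Notation U := dual_operator.

(** The forward chain prepends its letters to the word that is being
    composed, which is why the weight is that of the reversed word and why the
    last symbol visited is the first letter; for the empty word it is [i]. *)
Lemma iter_dualE n f x i : iter n U f (x, i) =
  \sum_(w : n.-tuple (symbol k)) path_weight P i (rev w) * f (word_map T w x, head i w).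
Proof.
elim: n x i => [|n ih] x i.
  by rewrite (sum_word0 (fun w => path_weight P i (rev w) * f (word_map T w x, head i w))) mul1r.
rewrite iterS /dual_operator /=.
rewrite (sum_word_rcons n (fun w => path_weight P i (rev w) * f (word_map T w x, head i w))).
apply: eq_bigr => j _; rewrite ih mulr_sumr; apply: eq_bigr => w _.
by rewrite rev_rcons /= mulrA word_map_rcons headI.
Qed.

(** Weighting the start by the stationary vector turns weights of forward
    paths into masses for the inverse chain. *)
Lemma iter_dual_mass n f x i : p 0 i * iter n U f (x, i) =
  \sum_(w : n.-tuple (symbol k)) mass (rcons w i) * f (word_map T w x, head i w).
Proof.
rewrite iter_dualE mulr_sumr; apply: eq_bigr => w _.
by rewrite word_mass_rcons mulrA.
Qed.

Lemma sum_path_weight n i :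
  \sum_(w : n.-tuple (symbol k)) path_weight P i (rev w) = 1.
Proof.
have <- : iter n U (fun=> 1) (point, i) = 1.
  elim: n i => // n ih i; rewrite iterS /dual_operator /=.
  have iter1 m : iter m U (fun=> 1) = fun=> 1.
    elim: m => // m ihm; rewrite iterS ihm; apply/funext => z.
    rewrite /dual_operator; under eq_bigr do rewrite mulr1.
    by case: hP => _; exact.
  by rewrite iter1; under eq_bigr do rewrite mulr1; case: hP => _; exact.
by rewrite iter_dualE; apply: eq_bigr => w _; rewrite mulr1.
Qed.

Lemma iter_dual_dist n f g (e : R) : (forall z, `|f z - g z| <= e) ->
  forall z, `|iter n U f z - iter n U g z| <= e.
Proof.
move=> fg [x i]; rewrite !iter_dualE -sumrB.
apply: (le_trans (ler_norm_sum _ _ _)).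
rewrite -[leRHS]mul1r -(sum_path_weight n i) mulr_suml; apply: ler_sum => w _.
by rewrite -mulrBr normrM ger0_norm ?path_weight_ge0// ler_wpM2l// path_weight_ge0.
Qed.

Definition ext_map (j : symbol k) (z : Xhat) : Xhat := (T j z.1, j).

Lemma ext_map_continuous j : continuous (ext_map j).
Proof.
move=> z; apply: (@cvg_pair _ _ _ (nbhs z) (nbhs (T j z.1)) (nbhs j)
  _ _ _ (fun y : Xhat => T j y.1) (fun=> j)); last exact: cvg_cst.
apply: (@continuous_comp Xhat X X fst (T j)); last exact: hT.
exact: cvg_fst.
Qed.

Lemma dual_continuous f : continuous f -> continuous (U f).
Proof.
move=> cf; apply: (continuous_big (@add_continuous R^o)) => j _ z.
have cP : continuous (fun z : Xhat => P z.2 j).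
  apply/ext_continuousP => x i e e0; exists 1 => // y _.
  by rewrite subrr normr0.
have cfj : {for z, continuous (f \o ext_map j)}.
  by apply: continuous_comp; [exact: ext_map_continuous|exact: cf].
exact: (continuousM (cP z) cfj).
Qed.

(** Two starting points with the same symbol are driven together: their
    images under a word differ by more than [d] only on a set of words of
    vanishing mass. *)
Lemma iter_dual_oscillation n f (M e d : R) : 0 <= e -> (forall z, `|f z| <= M) ->
  (forall x y i, `|ucoord x - ucoord y| < d -> `|f (x, i) - f (y, i)| < e) ->
  forall x y i, p 0 i * `|iter n U f (x, i) - iter n U f (y, i)| <=
    e + 2 * M * diam_mass d n.
Proof.
move=> e0 fM fe x y i.
have p0 : 0 <= p 0 i by case: hp.
have M0 : 0 <= M by apply: le_trans (fM point).
rewrite -[p 0 i]ger0_norm// -normrM mulrBr !iter_dual_mass -sumrB.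
apply: (le_trans (ler_norm_sum _ _ _)).
have -> : e = \sum_(w : n.-tuple (symbol k)) mass w * e.
  by rewrite -mulr_suml sum_word_mass// mul1r.
rewrite mulr_sumr -big_split /=.
apply: ler_sum => w _; rewrite -mulrBr normrM ger0_norm ?word_mass_ge0//.
apply: (@le_trans _ _ (mass w * `|f (word_map T w x, head i w) - f (word_map T w y, head i w)|)).
  by rewrite ler_wpM2r// -cats1 word_mass_cat_le.
rewrite mulrCA -mulrDr ler_wpM2l ?word_mass_ge0//.
case: (lerP d (image_diam w)) => [_|wd].
  rewrite mulr1 (le_trans (ler_normB _ _))// (le_trans (lerD (fM _) (fM _)))//.
  lra.
rewrite mulr0 addr0 ltW//; apply: fe; apply: le_lt_trans wd.
by apply: le_diam; [exists x|exists y].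
Qed.

Lemma iter_dual_continuous n f : continuous f -> continuous (iter n U f).
Proof. by move=> cf; elim: n => // n ih; exact: dual_continuous. Qed.

Definition symbol_indicator (j : symbol k) (z : Xhat) : R := (z.2 == j)%:R.

Lemma iter_dual_symbol n (g : symbol k -> R) x i :
  iter n U (fun z => g z.2) (x, i) =
  \sum_j g j * iter n U (symbol_indicator j) (x, i).
Proof.
under [RHS]eq_bigr do rewrite iter_dualE mulr_sumr.
rewrite exchange_big iter_dualE; apply: eq_bigr => w _ /=.
rewrite (bigD1 (head i w))//= /symbol_indicator /= eqxx mulr1 mulrC.
rewrite big1 ?addr0// => j jw.
by rewrite [_ == j]eq_sym (negPf jw) !mulr0.
Qed.

Definition stationary_average (f : Xhat -> R) : R := \sum_i p 0 i * f (point, i).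

(** After many steps the function hardly depends on the point any more, only
    on the symbol; the remaining dependence on the symbol is averaged out by
    the mixing Markov chain. *)
Lemma iter_dual_cvg f c : (forall i, 0 < p 0 i) ->
  (forall d, 0 < d -> diam_mass d n @[n --> \oo] --> 0) ->
  (forall x i j, iter n U (symbol_indicator j) (x, i) @[n --> \oo] --> p 0 j) ->
  continuous f ->
  stationary_average (iter n U f) @[n --> \oo] --> c ->
  forall e, 0 < e -> \forall n \near \oo, forall z, `|iter n U f z - c| < e.
Proof.
move=> p_gt0 diam0 mix cf avg e e0.
have e30 : 0 < e / 3 by rewrite divr_gt0.
have [M M0 fM] := ext_continuous_bounded cf.
(* a time after which the base point matters little *)
have [n [avg_n osc_n]] : exists n, `|stationary_average (iter n U f) - c| < e / 3 /\
    forall x y i, `|iter n U f (x, i) - iter n U f (y, i)| < e / 3.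
  pose q := \big[Num.min/1]_i p 0 i.
  have q0 : 0 < q by apply: lt_bigmin => // i _.
  have qp i : q <= p 0 i by exact: bigmin_le_cond.
  pose e' := q * (e / 3) / 2.
  have e'0 : 0 < e' by rewrite divr_gt0// mulr_gt0.
  have [d d0 fd] := ext_continuous_unif cf e'0.
  have near_avg : \forall n \near \oo, `|c - stationary_average (iter n U f)| < e / 3.
    by move/cvgrPdist_lt : avg; exact.
  have near_diam : \forall n \near \oo, 2 * M * diam_mass d n < e'.
    have /cvgrPdist_lt/(_ (e' / (2 * M))) := diam0 _ d0.
    rewrite divr_gt0// ?mulr_gt0// => /(_ isT); apply: filterS => n.
    rewrite sub0r normrN ger0_norm ?diam_mass_ge0//.
    by rewrite ltr_pdivlMr ?mulr_gt0// mulrC.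
  have [n [avg_n diam_n]] := filter_ex (filterI near_avg near_diam).
  exists n; split=> [|x y i]; first by rewrite distrC.
  rewrite -(ltr_pM2l (p_gt0 i)).
  apply: le_lt_trans (iter_dual_oscillation n (ltW e'0) fM fd x y i) _.
  apply: (@lt_le_trans _ _ (q * (e / 3))); last by rewrite ler_wpM2r// ltW.
  by rewrite [ltRHS]splitr ltrD2l.
(* [h] is nearly the function [g] of the symbol alone *)
pose h := iter n U f; pose g (j : symbol k) := h (point, j).
have mixg i : iter m U (fun z => g z.2) (point, i) @[m --> \oo] --> stationary_average h.
  under eq_fun do rewrite iter_dual_symbol.
  rewrite /stationary_average; under eq_bigr do rewrite mulrC.
  by apply: cvg_sumr => j; apply: cvgMl_tmp; exact: mix.
have near_mix : \forall m \near \oo, forall i,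
    `|stationary_average h - iter m U (fun z => g z.2) (point, i)| < e / 3.
  by apply: filter_forall => i; have /cvgrPdist_lt/(_ _ e30) := mixg i.
case: near_mix => m0 _ mixed.
exists (m0 + n)%N => // N /= mN [x i].
have [m m0m ->] : exists2 m, (m0 <= m)%N & N = (m + n)%N.
  exists (N - n)%N; first by rewrite leq_subRL ?(leq_trans (leq_addl _ _) mN)// addnC.
  by rewrite subnK// (leq_trans (leq_addl _ _) mN).
rewrite iterD -/h.
have sym y : iter m U (fun z => g z.2) (y, i) = iter m U (fun z => g z.2) (point, i).
  by rewrite !iter_dualE.
have := mixed m m0m i; rewrite -(sym x).
have : `|iter m U h (x, i) - iter m U (fun z => g z.2) (x, i)| <= e / 3.
  by apply: iter_dual_dist => -[y j]; exact/ltW/osc_n.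
move: avg_n; rewrite -/h !(ltr_norml, ler_norml).
by move=> /andP[? ?] /andP[? ?] /andP[? ?]; apply/andP; split; lra.
Qed.

End contraction_in_mean.

(** * Functions of finitely many letters *)

Section prefix_functions.
Variables (R : realType) (k : nat).
Local Notation Omega := (borel (shift_space k)).
Implicit Types (w : shift_space k) (s : seq (symbol k)).

Lemma cylinderE s w : cylinder s w <-> mkseq w (size s) = s.
Proof.
split=> [ws|<- i]; last by rewrite size_mkseq => iw; rewrite nth_mkseq.
apply: (@eq_from_nth _ ord0); rewrite size_mkseq// => i si.
by rewrite nth_mkseq// ws.
Qed.

Lemma measurable_cylinder s : measurable (cylinder s : set Omega).
Proof.
have -> : cylinder s = \bigcap_(i in `I_(size s)) [set w : shift_space k | w i = nth ord0 s i].
  by apply/seteqP; split.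
apply: fin_bigcap_measurable; first exact: finite_II.
move=> i _; apply: sub_sigma_algebra.
have /continuousP : continuous (fun w : shift_space k => w i).
  exact: (@proj_continuous nat (fun=> symbol k) i).
by move=> /(_ [set nth ord0 s i]); apply; exact: discrete_open.
Qed.

(** A preimage is a finite union of cylinders. *)
Lemma measurable_prefix d (Y : measurableType d) n (G : seq (symbol k) -> Y) :
  measurable_fun setT (fun w : Omega => G (mkseq (w : shift_space k) n)).
Proof.
move=> _ B _; rewrite setTI.
have -> : (fun w : Omega => G (mkseq (w : shift_space k) n)) @^-1` B =
    \bigcup_(s in [set s : n.-tuple (symbol k) | B (G s)]) cylinder s.
  apply/seteqP; split=> [w /= Bw|w [s /= Bs /cylinderE]]; last first.
    by rewrite size_tuple => ->.
  have sz : size (mkseq w n) == n by rewrite size_mkseq.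
  by exists (Tuple sz) => //; apply/cylinderE; rewrite /= size_mkseq.
by apply: fin_bigcup_measurable => // s _; exact: measurable_cylinder.
Qed.

Variables (Q : probability Omega R) (m : seq (symbol k) -> R).
Hypothesis Qm : forall s, Q (cylinder s) = (m s)%:E.

Lemma integral_prefix n (G : seq (symbol k) -> R) :
  (\int[Q]_w (G (mkseq (w : shift_space k) n))%:E =
   (\sum_(s : n.-tuple (symbol k)) m s * G s)%:E)%E.
Proof.
have -> : (fun w : Omega => (G (mkseq (w : shift_space k) n))%:E) =
    (fun w => \sum_(s : n.-tuple (symbol k)) (G s)%:E * (\1_(cylinder s) w)%:E)%E.
  apply/funext => w; have sz : size (mkseq w n) == n by rewrite size_mkseq.
  rewrite (bigD1 (Tuple sz))//= big1 ?adde0 => [|s ws].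
    by rewrite indicE mem_set ?mule1//; apply/cylinderE; rewrite size_mkseq.
  rewrite indicE memNset ?mule0// => /cylinderE; rewrite size_tuple => wE.
  by case/negP: ws; apply/eqP/val_inj.
have iG (s : n.-tuple (symbol k)) : Q.-integrable setT
    (fun w => ((G s)%:E * (\1_(cylinder s) w)%:E)%E).
  by apply: integrableZl => //; apply: integrable_indic; exact: measurable_cylinder.
rewrite integral_sum// -sumEFin; apply: eq_bigr => s _.
rewrite integralZl//; last by apply: integrable_indic; exact: measurable_cylinder.
rewrite integral_indic//; last exact: measurable_cylinder.
rewrite setIT mulrC EFinM; congr (_ * _)%E; exact: Qm.
Qed.

Lemma probability_prefix n (b : pred (seq (symbol k))) :
  Q [set w | b (mkseq (w : shift_space k) n)] =
  (\sum_(s : n.-tuple (symbol k)) m s * (b s)%:R)%:E.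
Proof.
rewrite -(integral_prefix n (fun s => (b s)%:R)).
have mb : measurable ([set w | b (mkseq (w : shift_space k) n)] : set Omega).
  by have := @measurable_prefix _ _ n (b : seq _ -> bool) measurableT [set true] I; rewrite setTI.
transitivity (\int[Q]_w (\1_[set w : Omega | b (mkseq (w : shift_space k) n)] w)%:E)%E.
  by rewrite integral_indic ?setIT.
apply: eq_integral => w _; rewrite indicE; congr ((nat_of_bool _)%:R%:E).
by apply/idP/idP => [/set_mem|/mem_set].
Qed.

End prefix_functions.

(** * Almost sure weak hyperbolicity *)

Section almost_sure_hyperbolicity.
Variables (R : realType) (k : nat).
Local Notation Omega := (borel (shift_space k)).
Local Notation X := (unit_interval R).
Variable T : symbol k -> X -> X.
Variables (P : 'M[R]_k.+1) (p : 'rV[R]_k.+1).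
Hypotheses (hP : transition_matrix P) (hp : stationary_vector P p).
Variable Q : probability Omega R.
Hypothesis hQ : forall s, Q (cylinder s) = (word_mass P p s)%:E.

Lemma orbit_diam_nonincr w : nonincreasing_seq (fun n => diam (range (orbit_map T w n))).
Proof.
move=> m n mn; apply: diam_le_subset; first exact: range_word_map_neq0.
move=> _ [x _ <-]; have [y ->] := orbit_map_nested T w x mn.
by exists y.
Qed.

(** The diameters are nonincreasing, so that they tend to zero as soon as they
    take arbitrarily small values; this gives countably many conditions on
    finitely many letters each. *)
Lemma weakly_hyperbolicE : weakly_hyperbolic T =
  \bigcap_N \bigcup_n [set w | diam (range (orbit_map T w n)) < N.+1%:R^-1].
Proof.
apply/seteqP; split=> w hw.
  move=> N _; have /cvgrPdist_lt/(_ N.+1%:R^-1) := hw.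
  rewrite invr_gt0 ltr0n => /(_ isT)[n _ /(_ n (leqnn n))] /= wn.
  by exists n => //=; move: wn; rewrite sub0r normrN; exact/le_lt_trans/ler_norm.
apply/cvgrPdist_lt => e e0.
have [N _ /(_ N (leqnn N)) /= Ne] := near_infty_natSinv_lt (PosNum e0).
have [n _ /= wn] := hw N I.
exists n => // m /= nm; rewrite sub0r normrN ger0_norm ?diam_ge0//.
by apply: le_lt_trans (orbit_diam_nonincr w nm) _; exact: lt_trans Ne.
Qed.

Lemma measurable_small_diam e n :
  measurable ([set w | diam (range (orbit_map T w n)) < e] : set Omega).
Proof.
have := @measurable_prefix k _ _ n.+1 (fun s => diam (range (word_map T s)) < e)
  measurableT [set true] I.
by rewrite setTI.
Qed.

Lemma measurable_weakly_hyperbolic : measurable (weakly_hyperbolic T : set Omega).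
Proof.
rewrite weakly_hyperbolicE; apply: bigcapT_measurable => N.
by apply: bigcupT_measurable => n; exact: measurable_small_diam.
Qed.

(** A sequence that is not weakly hyperbolic has, for some [N], diameters at
    least [1 / (N + 1)] at all times, and the mass of the words with such an
    image tends to zero. *)
Lemma weakly_hyperbolic_ae :
  (forall e, 0 < e -> diam_mass T P p e n @[n --> \oo] --> 0) ->
  Q (~` weakly_hyperbolic T) = 0%E.
Proof.
move=> diam0.
pose big N n := [set w : Omega | N.+1%:R^-1 <= diam (range (orbit_map T w n))].
have mbig N n : measurable (big N n).
  rewrite [big _ _](_ : _ = ~` [set w | diam (range (orbit_map T w n)) < N.+1%:R^-1]).
    by apply: measurableC; exact: measurable_small_diam.
  by apply/seteqP; split=> w; rewrite /setC /big /= leNgt => /negP.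
have -> : ~` weakly_hyperbolic T = \bigcup_N \bigcap_n big N n.
  rewrite weakly_hyperbolicE setC_bigcap; apply: eq_bigcupr => N _.
  rewrite setC_bigcup; apply: eq_bigcapr => n _.
  by apply/seteqP; split=> w; rewrite /setC /big /= leNgt => /negP.
apply/negligibleP.
  by apply: bigcupT_measurable => N; apply: bigcapT_measurable.
apply: negligible_bigcup => N; exists (\bigcap_n big N n); split => //.
  exact: bigcapT_measurable.
have Qbig n : Q (big N n) = (diam_mass T P p N.+1%:R^-1 n.+1)%:E.
  rewrite /diam_mass -(probability_prefix hQ n.+1
    (fun s => N.+1%:R^-1 <= diam (range (word_map T s)))) //.
apply: le_anti; rewrite measure_ge0 andbT.
have -> : 0%E = limn (fun n => (diam_mass T P p N.+1%:R^-1 n.+1)%:E).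
  apply/esym/cvg_lim => //; apply: cvg_EFin; first exact: nearW.
  by rewrite (cvg_shiftS (diam_mass T P p N.+1%:R^-1)); apply: diam0.
apply: lime_ge.
  apply/cvg_ex; exists 0%E; apply: cvg_EFin; first exact: nearW.
  by rewrite (cvg_shiftS (diam_mass T P p N.+1%:R^-1)); apply: diam0.
apply: nearW => n; rewrite -Qbig; apply: le_measure; rewrite ?inE//.
  exact: bigcapT_measurable.
exact: bigcap_inf.
Qed.

(** The mass of the words with first letter [j] and letter [i] at time [n] is
    [p 0 i] times the probability that the forward chain goes from [i] to [j]
    in [n] steps; mixing makes it tend to [p 0 i * p 0 j]. *)
Lemma mixing_dual_cvg : (forall a, 0 < p 0 a) -> mixing Q -> forall x i j,
  iter n (dual_operator T P) (symbol_indicator j) (x, i) @[n --> \oo] --> p 0 j.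
Proof.
move=> p_gt0 mixQ x i j.
have letter a : Q (cylinder [:: a]) = (p 0 a)%:E.
  by rewrite hQ (word_mass_rcons _ _ [::]) mulr1.
have := mixQ _ _ (measurable_cylinder [:: i]) (measurable_cylinder [:: j]).
rewrite !letter -EFinM.
have -> : (fun n => Q ((iter n (@Defs.shift k) @^-1` cylinder [:: i]) `&` cylinder [:: j])) =
    (fun n => (p 0 i * iter n (dual_operator T P) (symbol_indicator j) (x, i))%:E).
  apply/funext => n.
  have shiftE (w : shift_space k) l : iter n (@Defs.shift k) w l = w (n + l)%N.
    by elim: n l => // n ih l; rewrite iterS /Defs.shift ih addSnnS.
  have cyl1 a (w : shift_space k) : cylinder [:: a] w <-> w 0%N = a.
    by rewrite cylinderE; split=> [[]//|<-].
  rewrite iter_dual_mass.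
  transitivity (Q [set w | [&& nth ord0 (mkseq w n.+1) n == i & head i (mkseq w n.+1) == j]]).
    congr (Q _); apply/seteqP; split=> w; rewrite /setI /= nth_mkseq//.
      by move=> [/cyl1 + /cyl1 ->]; rewrite shiftE addn0 => ->; rewrite !eqxx.
    move=> /andP[/eqP wi /eqP wj]; split; apply/cyl1 => //.
    by rewrite shiftE addn0.
  rewrite (probability_prefix hQ n.+1 (fun s => [&& nth ord0 s n == i & head i s == j])).
  rewrite (sum_word_rcons n
    (fun s => word_mass P p s * [&& nth ord0 s n == i & head i s == j]%:R)).
  congr EFin; rewrite (bigD1 i)//= [X in _ + X]big1 ?addr0 => [|a ai].
    apply: eq_bigr => w _; rewrite nth_rcons size_tuple ltnn eqxx eqxx/=.
    by case: w => -[].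
  apply: big1 => w _; rewrite nth_rcons size_tuple ltnn eqxx.
  by rewrite (negPf ai) mulr0.
move=> /fine_cvg pcvg.
have -> : p 0 j = (p 0 i)^-1 * (p 0 i * p 0 j) by rewrite mulKf// gt_eqF.
rewrite (_ : (fun n => _) = (fun n => (p 0 i)^-1 *
    (p 0 i * iter n (dual_operator T P) (symbol_indicator j) (x, i)))).
  exact: cvgMl_tmp.
by apply/funext => n; rewrite mulKf// gt_eqF.
Qed.

End almost_sure_hyperbolicity.

(** * Borel measures on the extended space *)

Lemma continuous_borel_measurable (R : realType) (S : ptopologicalType) (f : S -> R) :
  continuous f -> measurable_fun setT (f : borel S -> R).
Proof.
move=> /continuousP cf; apply: (measurability _ (RGenOpens.measurableE R)).
move=> _ [_ [a [b ->]] <-]; rewrite setTI; apply: sub_sigma_algebra.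
by apply: cf; exact: interval_open.
Qed.

Lemma continuous_borel_map (S S' : ptopologicalType) (g : S -> S') :
  continuous g -> measurable_fun setT (g : borel S -> borel S').
Proof.
move=> /continuousP cg; apply: (@measurability _ _ (borel S) (borel S') _ _ (@open S')).
  by [].
by move=> _ [C oC <-]; rewrite setTI; apply: sub_sigma_algebra; exact: cg.
Qed.

Section ext_measures.
Variables (R : realType) (k : nat).
Local Notation X := (unit_interval R).
Local Notation Xhat := (ext_space R k).
Implicit Types (mu nu : probability (borel Xhat) R) (f : Xhat -> R).

Lemma integrable_continuous mu f : continuous f ->
  mu.-integrable setT (EFin \o (f : borel Xhat -> R)).
Proof.
move=> cf; apply: measurable_bounded_integrable => //.
- by apply: (@le_lt_trans _ _ 1%E); [exact: probability_le1|exact: ltry].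
- exact: continuous_borel_measurable.
have [M M0 fM] := ext_continuous_bounded cf.
by exists M; split => [|x Mx z _]; [exact: num_real|exact: le_trans (fM z) (ltW Mx)].
Qed.

Lemma integral_continuousE mu f : continuous f ->
  (\int[mu]_x (f x)%:E = (\int[mu]_x f x)%:E)%E.
Proof.
by move=> cf; rewrite fineK//; apply: integrable_fin_num => //; exact: integrable_continuous.
Qed.

Lemma Rintegral_dist mu f (c e : R) : continuous f ->
  (forall z, `|f z - c| <= e) -> `|\int[mu]_x f x - c| <= e.
Proof.
move=> cf fce.
have cfc : continuous (fun z => f z - c).
  by move=> z; apply: cvgB; [exact: cf|exact: cvg_cst].
have cst_int r : \int[mu]_x (fun=> r) x = r :> R.
  rewrite Rintegral_cst//.
  by rewrite -[RHS]mulr1; have -> : fine (mu setT) = 1 by rewrite (probability_setT mu).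
have cc r : continuous (fun _ : Xhat => r : R) by move=> z; exact: cvg_cst.
rewrite -[X in _ - X](cst_int c) -RintegralB//; [|exact: integrable_continuous..].
apply: le_trans (le_normr_Rintegral _ _) _ => //; first exact: integrable_continuous.
rewrite -[leRHS](cst_int e); apply: le_Rintegral => //.
- apply: (@integrable_continuous mu (fun z => `|f z - c|)) => z.
  by apply: cvg_norm; exact: cfc.
- exact: integrable_continuous.
Qed.

(** Where the depth is positive the ramps end up equal to 1, and elsewhere they
    vanish. *)
Lemma ramp_cvg (U : set Xhat) z : open U ->
  Num.min 1 (n%:R * depth U z) @[n --> \oo] --> (\1_U z : R).
Proof.
move=> oU; rewrite indicE; case: (boolP (z \in U)) => [|/negP] zU; last first.
  have -> : depth U z = 0 by apply: depth_notin => /mem_set.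
  under eq_fun do rewrite mulr0 min_r//.
  exact: cvg_cst.
have d0 : 0 < depth U z by apply: depth_gt0 => //; exact: set_mem.
apply: cvg_near_cst; exists (Num.truncn (depth U z)^-1).+1 => // n /= nd.
apply/min_idPl; rewrite -ler_pdivrMr// div1r.
by apply: le_trans (ltW (real_truncnS_gt (num_real _))) _; rewrite ler_nat.
Qed.

Lemma ramp_continuous (U : set Xhat) n :
  continuous (fun z => Num.min 1 (n%:R * depth U z)).
Proof.
move=> z; apply: (@continuous_min R Xhat (fun=> 1) (fun z => n%:R * depth U z)).
  exact: cvg_cst.
by apply: cvgMl_tmp; exact: depth_continuous.
Qed.

Lemma ramp_itv (U : set Xhat) n z : 0 <= Num.min 1 (n%:R * depth U z) <= 1.
Proof. by rewrite le_min ler01 mulr_ge0 ?depth_ge0//= ge_min lexx. Qed.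

Lemma open_ramp_measure mu (U : set Xhat) : open U ->
  (\int[mu]_z (Num.min 1 (n%:R * depth U z))%:E @[n --> \oo] --> mu U)%E.
Proof.
move=> oU; have mU : measurable (U : set (borel Xhat)) by exact: sub_sigma_algebra.
have -> : mu U = (\int[mu]_z (\1_U z)%:E)%E by rewrite integral_indic ?setIT.
have [||||| _ _ ] := @dominated_convergence _ (borel Xhat) R mu setT measurableT
  (fun n z => (Num.min 1 (n%:R * depth U z))%:E) (fun z => (\1_U z)%:E) (cst 1%E).
- move=> n; apply/measurable_EFinP.
  by apply: continuous_borel_measurable; exact: ramp_continuous.
- exact/measurable_EFinP/measurable_indic.
- apply: aeW => z _; apply: cvg_EFin; first exact: nearW.
  exact: ramp_cvg.
- exact: finite_measure_integrable_cst.
- apply: aeW => z n _ /=; have /andP[r0 r1] := ramp_itv U n z.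
  by rewrite lee_fin ger0_norm.
- exact.
Qed.

(** Indicators of open sets are limits of continuous ramps, and open sets are
    stable under intersection and generate the Borel sets. *)
Lemma eq_on_borel_continuous mu nu :
  (forall f, continuous f -> \int[mu]_x (f x)%:E = \int[nu]_x (f x)%:E)%E ->
  eq_on_borel mu nu.
Proof.
move=> fE; apply: (@measure_unique _ R (borel Xhat) (@open Xhat) (fun=> setT)) => //.
- by move=> A B; exact: openI.
- by move=> _; exact: openT.
- by rewrite bigcup_const.
- move=> U oU.
  have limE (m : probability (borel Xhat) R) :
      limn (fun n => \int[m]_z (Num.min 1 (n%:R * depth U z))%:E)%E = m U.
    by apply/cvg_lim => //; exact: open_ramp_measure.
  apply: etrans (esym (limE mu)) _; apply: etrans (limE nu).
  by congr (lim (_ @ \oo)); apply/funext => n; apply: fE; exact: ramp_continuous.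
- by move=> _; apply: (@le_lt_trans _ _ 1%E); [exact: probability_le1|exact: ltry].
Qed.

End ext_measures.

(** * Duality between the Markov operator and the dual operator *)

Section markov_duality.
Variables (R : realType) (k : nat).
Local Notation X := (unit_interval R).
Local Notation Xhat := (ext_space R k).
Variable T : symbol k -> X -> X.
Variable P : 'M[R]_k.+1.
Hypotheses (hP : transition_matrix P) (hT : forall i, continuous (T i)).
Implicit Types (mu : probability (borel Xhat) R) (f : Xhat -> R).
Local Notation S := (markov_operator hP hT).
Local Notation U := (dual_operator T P).

Let fibre (i : symbol k) : set (borel Xhat) := snd @^-1` [set i].

Let measurable_fibre i : measurable (fibre i).
Proof.
apply: sub_sigma_algebra.
have /continuousP : continuous (snd : Xhat -> symbol k) by move=> x; exact: cvg_snd.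
by apply; exact: discrete_open.
Qed.

Let measurable_ext_map j : measurable_fun setT (ext_map T j : borel Xhat -> borel Xhat).
Proof. by apply: continuous_borel_map; exact: ext_map_continuous. Qed.

(** The image of the Markov operator is the sum, weighted by [P i j], of the
    measures transported by the jumps from [i] to [j]. *)
Let branch mu (i j : symbol k) : {measure set (borel Xhat) -> \bar R} :=
  measure_function_pushforward__canonical__measure_function_Measure
    (mrestr mu (measurable_fibre i)) (measurable_ext_map j).

(** Change of variables along the jump; the restriction to the fibre turns
    from a restriction of the measure into a domain of integration. *)
Let integral_branch mu i j f : measurable_fun setT (f : borel Xhat -> R) ->
  (forall z, 0 <= f z) ->
  (\int[branch mu i j]_z (f z)%:E = \int[mu]_(z in fibre i) (f (ext_map T j z))%:E)%E.
Proof.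
move=> mf f0.
have mfj : measurable_fun setT (fun z : borel Xhat => (f (ext_map T j z))%:E).
  apply/measurable_EFinP.
  exact: (measurableT_comp mf (measurable_ext_map j)).
rewrite (ge0_integral_pushforward (measurable_ext_map j))//; [|exact/measurable_EFinP|by move=> z _; rewrite lee_fin].
rewrite preimage_setT (@ge0_negligible_integral _ _ _ _ _ (~` fibre i))//.
- rewrite setDE setCK setTI; apply: eq_measure_integral => A mA Ai.
  by rewrite /= /mrestr setIidl.
- exact: measurableC.
- by move=> z _; rewrite lee_fin.
- by rewrite -[LHS]/(mu (~` fibre i `&` fibre i)) setICl measure0.
Qed.

Let markov_branches mu : {measure set (borel Xhat) -> \bar R} :=
  msum (fun i => msum (fun j =>
    mscale (NngNum (proj1 hP (inord i) (inord j))) (branch mu (inord i) (inord j))) k.+1) k.+1.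

Let markov_branchesE mu B : measurable B -> markov_branches mu B = S mu B.
Proof.
move=> mB; rewrite markov_operatorE /markov_fun /markov_branches /msum /=.
apply: eq_bigr => i _; apply: eq_bigr => j _; rewrite !inord_val /mscale /=.
by congr (_ * mu _)%E.
Qed.

Lemma ge0_integral_markov mu f : continuous f -> (forall z, 0 <= f z) ->
  (\int[S mu]_z (f z)%:E = \int[mu]_z (U f z)%:E)%E.
Proof.
move=> cf f0; have mf : measurable_fun setT (f : borel Xhat -> R).
  exact: continuous_borel_measurable.
have mUf : measurable_fun setT (U f : borel Xhat -> R).
  by apply: continuous_borel_measurable; exact: dual_continuous.
have Uf0 z : 0 <= U f z by apply: sumr_ge0 => j _; rewrite mulr_ge0//; case: hP.
rewrite (eq_measure_integral (markov_branches mu)) => [|A mA _]; last first.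
  by rewrite markov_branchesE.
rewrite ge0_integral_measure_sum//; [|by move=> z _; rewrite lee_fin|exact/measurable_EFinP].
have setTE : [set: borel Xhat] = \big[setU/set0]_(i <- index_enum 'I_k.+1) fibre i.
  apply/seteqP; split=> // z _; rewrite -bigcup_seq.
  by exists z.2 => //=; rewrite mem_index_enum.
rewrite [RHS](_ : _ = \int[mu]_(z in \big[setU/set0]_(i <- index_enum 'I_k.+1) fibre i)
    (U f z)%:E)%E; last by rewrite -setTE.
rewrite ge0_integral_bigsetU//; last 4 first.
- exact: index_enum_uniq.
- by move=> i j _ _ [z [/= <- <-]].
- by rewrite -setTE; exact/measurable_EFinP.
- by move=> z _; rewrite lee_fin.
apply: eq_bigr => i _.
rewrite ge0_integral_measure_sum//; [|by move=> z _; rewrite lee_fin|exact/measurable_EFinP].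
have mfj j : measurable_fun setT (fun z : borel Xhat => (f (ext_map T j z))%:E).
  by apply/measurable_EFinP; exact: (measurableT_comp mf (measurable_ext_map j)).
transitivity (\int[mu]_(z in fibre i) \sum_(j < k.+1) ((P i j)%:E * (f (ext_map T j z))%:E))%E.
  rewrite ge0_integral_sum//; last 2 first.
  - by move=> j; apply: measurable_funeM; exact: measurable_funTS.
  - by move=> j z _; rewrite mule_ge0// lee_fin//; case: hP.
  apply: eq_bigr => j _; rewrite ge0_integral_mscale//; last 2 first.
  - exact/measurable_EFinP.
  - by move=> z _; rewrite lee_fin.
  rewrite integral_branch// !inord_val /= ge0_integralZl//.
  - exact: measurable_funTS.
  - by move=> z _; rewrite lee_fin.
  - by rewrite lee_fin; case: hP.
apply: eq_integral => z; rewrite inE => -[zi].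
rewrite /dual_operator zi -sumEFin; apply: eq_bigr => j _.
by rewrite EFinM.
Qed.

Lemma dualD f g z : U (fun y => f y + g y) z = U f z + U g z.
Proof.
by rewrite /dual_operator -big_split; apply: eq_bigr => j _; rewrite /= mulrDr.
Qed.

Lemma dual_cst (c : R) z : U (fun=> c) z = c.
Proof. by rewrite /dual_operator -mulr_suml; case: hP => _ ->; rewrite mul1r. Qed.

(** The dual operator commutes with the addition of constants, so that a
    bounded function may be shifted to a nonnegative one. *)
Lemma Rintegral_markov mu f : continuous f -> \int[S mu]_z f z = \int[mu]_z U f z.
Proof.
move=> cf; have [M M0 fM] := ext_continuous_bounded cf.
have cM : continuous (fun _ : Xhat => M) by move=> z; exact: cvg_cst.
have cfM : continuous (fun z => f z + M).
  by move=> z; apply: cvgD; [exact: cf|exact: cvg_cst].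
have fM0 z : 0 <= f z + M by move: (fM z); rewrite ler_norml => /andP[? _]; lra.
have cst_int (m : probability (borel Xhat) R) : \int[m]_x (fun=> M) x = M.
  rewrite Rintegral_cst// -[RHS]mulr1.
  by have -> : fine (m setT) = 1 by rewrite (probability_setT m).
have shifted (m : probability (borel Xhat) R) g : continuous g ->
    \int[m]_z (g z + M) = \int[m]_z g z + M.
  move=> cg; rewrite -[X in _ = _ + X](cst_int m) RintegralD//; exact: integrable_continuous.
apply: (addIr M); rewrite -!shifted//; last exact: dual_continuous.
rewrite /Rintegral (ge0_integral_markov mu cfM fM0).
congr fine; apply: eq_integral => z _.
by rewrite (dualD f (fun=> M)) dual_cst.
Qed.

Lemma Rintegral_iter_markov mu f n : continuous f ->
  \int[iter n S mu]_z f z = \int[mu]_z iter n U f z.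
Proof.
elim: n f => // n ih f cf; rewrite iterS Rintegral_markov// ih; last exact: dual_continuous.
by rewrite iterSr.
Qed.

End markov_duality.

(** * The image of the inverse Markov measure under the coding map *)

Section coding_image.
Variables (R : realType) (k : nat).
Local Notation Omega := (borel (shift_space k)).
Local Notation X := (unit_interval R).
Local Notation Xhat := (ext_space R k).
Variable T : symbol k -> X -> X.

Definition ext_orbit (n : nat) (w : shift_space k) : Xhat :=
  (orbit_map T w n point, w 0%N).

Lemma ext_orbit_cvg (f : Xhat -> R) w : continuous f -> weakly_hyperbolic T w ->
  f (ext_orbit n w) @[n --> \oo] --> f (ext_coding_map T w).
Proof.
move=> cf hw.
have orb : ext_orbit n w @[n --> \oo] --> ext_coding_map T w.
  apply: (@cvg_pair _ _ _ \oo (nbhs (coding_map T w)) (nbhs (w 0%N)) _ _ _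
    (fun n => orbit_map T w n point) (fun=> w 0%N)); last exact: cvg_cst.
  exact: coding_mapP.
exact: (cvg_comp _ _ orb (cf _)).
Qed.

(** The coding map is meaningful on weakly hyperbolic sequences only; a
    constant value elsewhere makes it a measurable map on the whole space
    without changing image measures, as those sequences have full measure. *)
Definition total_coding (w : Omega) : borel Xhat :=
  if `[< weakly_hyperbolic T w >] then ext_coding_map T w else point.

Lemma measurable_coding_fun (f : Xhat -> R) : continuous f ->
  measurable_fun (weakly_hyperbolic T : set Omega)
    (fun w : Omega => f (ext_coding_map T w)).
Proof.
move=> cf; apply: (@measurable_fun_cvg _ Omega R (weakly_hyperbolic T)
  (fun n w => f (ext_orbit n w)) (fun w => f (ext_coding_map T w))).
  move=> n; apply: measurable_funTS.
  exact: (@measurable_prefix k _ _ n.+1 (fun s => f (word_map T s point, head ord0 s))).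
by move=> w; exact: ext_orbit_cvg.
Qed.

(** An open set is where its depth is positive, and the depth along the
    coding map is a limit of functions of finitely many letters. *)
Lemma measurable_ext_coding (B : set (borel Xhat)) : measurable B ->
  measurable (weakly_hyperbolic T `&` ext_coding_map T @^-1` B : set Omega).
Proof.
have : measurable_fun (weakly_hyperbolic T : set Omega)
    (ext_coding_map T : Omega -> borel Xhat).
  apply: (@measurability _ _ Omega (borel Xhat) _ _ (@open Xhat)); first by [].
  move=> _ [U oU <-].
  have -> : weakly_hyperbolic T `&` ext_coding_map T @^-1` U =
      weakly_hyperbolic T `&` (fun w => depth U (ext_coding_map T w)) @^-1` `]0, +oo[.
    congr (_ `&` _); apply/seteqP; split => w /=; rewrite in_itv /= andbT.
      exact: depth_gt0.
    by move=> d0; apply: contrapT => /depth_notin d00; rewrite d00 ltxx in d0.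
  apply: (measurable_coding_fun (@depth_continuous R k U)) => //.
  exact: measurable_weakly_hyperbolic.
by move=> mc mB; apply: mc => //; exact: measurable_weakly_hyperbolic.
Qed.

Lemma measurable_total_coding : measurable_fun setT total_coding.
Proof.
move=> _ B mB; rewrite setTI.
have -> : total_coding @^-1` B = (weakly_hyperbolic T `&` ext_coding_map T @^-1` B) `|`
    (~` weakly_hyperbolic T `&` [set _ | B point]).
  apply/seteqP; split => w; rewrite /preimage /total_coding /=.
    by case: asboolP => hw Bw; [left|right].
  by case=> -[hw Bw]; [rewrite asboolT|rewrite asboolF].
apply: measurableU; first exact: measurable_ext_coding.
apply: measurableI; first by apply: measurableC; exact: measurable_weakly_hyperbolic.
have [Bp|NBp] := pselect (B point).
  by rewrite (_ : [set _ | _] = setT)//; apply/seteqP; split.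
by rewrite (_ : [set _ | _] = set0)//; apply/seteqP; split.
Qed.

HB.instance Definition _ := isMeasurableFun.Build _ _ Omega (borel Xhat)
  total_coding measurable_total_coding.

Variable Q : probability Omega R.
Hypothesis Q_hyperbolic : Q (~` weakly_hyperbolic T) = 0%E.

Definition coding_measure : probability (borel Xhat) R := distribution Q total_coding.

Lemma coding_measure_image : ext_coding_image T Q coding_measure.
Proof.
move=> B mB A; have mA : measurable A by exact: measurable_ext_coding.
split => //.
have mS := measurable_weakly_hyperbolic T.
have mcB : measurable (total_coding @^-1` B).
  by rewrite -[X in measurable X]setTI; exact: measurable_total_coding.
rewrite -[LHS]/(Q (total_coding @^-1` B)).
have Q0 : (Q (~` weakly_hyperbolic T) <= 0)%E by rewrite Q_hyperbolic.
apply: le_anti; apply/andP; split.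
  apply: (@le_trans _ _ (Q (A `|` ~` weakly_hyperbolic T))).
    apply: le_measure; rewrite ?inE//; first by apply: measurableU => //; exact: measurableC.
    move=> w; rewrite /preimage /total_coding /=.
    by case: asboolP => hw Bw; [left|right].
  apply: (le_trans (measureU2 _ _ _)) => //; first exact: measurableC.
  by rewrite -[leRHS]adde0; apply: leeD => //; exact: Q0.
apply: le_measure; rewrite ?inE// => w [hw Bw].
by rewrite /preimage /total_coding /= asboolT.
Qed.

(** Dominated convergence: along a weakly hyperbolic sequence the orbits of
    the base point converge to the value of the coding map. *)
Lemma coding_measure_cvg (f : Xhat -> R) : continuous f ->
  (\int[Q]_w (f (ext_orbit n w))%:E @[n --> \oo] --> \int[coding_measure]_z (f z)%:E)%E.
Proof.
move=> cf; have [M M0 fM] := ext_continuous_bounded cf.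
have mf := continuous_borel_measurable cf.
have -> : (\int[coding_measure]_z (f z)%:E = \int[Q]_w (f (total_coding w))%:E)%E.
  rewrite integral_distribution//; first exact/measurable_EFinP.
  apply: measurable_bounded_integrable => //.
  - by apply: (@le_lt_trans _ _ 1%E); [exact: probability_le1|exact: ltry].
  - exact: (measurableT_comp mf measurable_total_coding).
  - exists M; split => [|x Mx z _]; [exact: num_real|exact: le_trans (fM _) (ltW Mx)].
have [||||| _ _ ] := @dominated_convergence _ Omega R Q setT measurableT
  (fun n w => (f (ext_orbit n w))%:E) (fun w => (f (total_coding w))%:E) (cst M%:E).
- move=> n; apply/measurable_EFinP.
  exact: (@measurable_prefix k _ _ n.+1 (fun s => f (word_map T s point, head ord0 s))).
- by apply/measurable_EFinP; exact: (measurableT_comp mf measurable_total_coding).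
- exists (~` weakly_hyperbolic T); split => //.
    by apply: measurableC; exact: measurable_weakly_hyperbolic.
  move=> w; apply: contra_not => hw _; apply: cvg_EFin; first exact: nearW.
  by rewrite /total_coding asboolT//; exact: ext_orbit_cvg.
- exact: finite_measure_integrable_cst.
- by apply: aeW => w n _ /=; rewrite lee_fin.
- exact.
Qed.

End coding_image.

(** * Asymptotic stability *)

Lemma inverse_markov_mass (R : realType) (k : nat) (P : 'M[R]_k.+1)
    (Qplus Qminus : probability (borel (shift_space k)) R) :
  markov_measure P Qplus -> inverse_markov_measure Qplus Qminus ->
  exists2 p, stationary_vector P p &
    forall s, Qminus (cylinder s) = (word_mass P p s)%:E.
Proof.
move=> [p hp Qp] hinv; exists p => // s; rewrite hinv /word_mass.
case: (rev s) => [|a t]; last exact: Qp.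
rewrite -(probability_setT Qplus); congr (Qplus _).
by apply/seteqP; split.
Qed.

Section stability.
Variables (R : realType) (k : nat).
Local Notation X := (unit_interval R).
Local Notation Xhat := (ext_space R k).
Variable T : symbol k -> X -> X.
Hypothesis hT : forall i, continuous (T i).
Variables (P : 'M[R]_k.+1) (p : 'rV[R]_k.+1).
Hypotheses (hP : transition_matrix P) (hp : stationary_vector P p).
Variable Q : probability (borel (shift_space k)) R.
Hypothesis hQ : forall s, Q (cylinder s) = (word_mass P p s)%:E.
Local Notation U := (dual_operator T P).

(** Averaging over the starting symbol turns the dual operator into an
    integral over the reversed chain, which is the inverse Markov measure. *)
Lemma stationary_average_orbit (f : Xhat -> R) n :
  (stationary_average p (iter n.+1 U f))%:E = (\int[Q]_w (f (ext_orbit T n w))%:E)%E.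
Proof.
rewrite (integral_prefix hQ n.+1 (fun s => f (word_map T s point, head ord0 s))).
congr EFin; rewrite /stationary_average.
under eq_bigr do rewrite iter_dual_mass.
rewrite exchange_big; apply: eq_bigr => w _ /=.
rewrite -(sum_word_mass_rcons hp) mulr_suml; apply: eq_bigr => i _.
by case/tupleP: w.
Qed.

(** The two words of the splitting condition, preceded by a path from the given
    last letter to their common first letter. *)
Lemma splitting_hits (J : set X) : irreducible_matrix P -> splits_in T Q J ->
  forall x, hitting_mass T P p x n @[n --> \oo] --> 0.
Proof.
move=> hirr [TJ [a [s [t [Qs Qt st0 stJ]]]]].
have p_gt0 := stationary_gt0 hP hirr hp.
have TJ1 i := (TJ i).1; have TJ2 i := (TJ i).2.
apply: hitting_mass_cvg0 => // b.
have [d dab] := irreducible_path hP hirr a b.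
exists (rev d ++ a :: t, rev d ++ a :: s); split=> [||x w] /=.
- by apply: word_mass_connect => //; rewrite -lte_fin -hQ.
- by apply: word_mass_connect => //; rewrite -lte_fin -hQ.
- by rewrite !catA; exact: hits_disjoint TJ1 TJ2 st0 stJ _ _.
Qed.

Hypothesis Q_hyperbolic : Q (~` weakly_hyperbolic T) = 0%E.
Hypothesis p_gt0 : forall i, 0 < p 0 i.
Hypothesis diam0 : forall d, 0 < d -> diam_mass T P p d n @[n --> \oo] --> 0.
Hypothesis hmix : mixing Q.
Local Notation nu := (coding_measure T Q).
Local Notation S := (markov_operator hP hT).

(** Uniform convergence of the iterates of the dual operator gives convergence
    of the integrals for any starting measure. *)
Lemma markov_operator_cvg mu : weak_star_cvg (fun n => iter n S mu) nu.
Proof.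
move=> f cf; rewrite integral_continuousE//.
under eq_fun do rewrite integral_continuousE// Rintegral_iter_markov//.
apply: cvg_EFin; first exact: nearW.
apply/cvgrPdist_lt => e e0.
have avg : stationary_average p (iter n U f) @[n --> \oo] --> \int[nu]_z f z.
  have : (stationary_average p (iter n.+1 U f))%:E @[n --> \oo] --> (\int[nu]_z f z)%:E.
    rewrite -integral_continuousE//; under eq_fun do rewrite stationary_average_orbit.
    exact: coding_measure_cvg.
  by move/fine_cvg; rewrite -(cvg_shiftS (fun n => stationary_average p (iter n U f))).
have e20 : 0 < e / 2 by rewrite divr_gt0.
have := iter_dual_cvg hP hp p_gt0 diam0 (mixing_dual_cvg T hQ p_gt0 hmix) cf avg e20.
apply: filterS => n close; rewrite distrC /=.
apply: (@le_lt_trans _ _ (e / 2)); last by rewrite ltr_pdivrMr// ltr_pMr// ltr1n.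
apply: Rintegral_dist => [|z]; first exact: iter_dual_continuous.
exact/ltW/close.
Qed.

(** Two iterations of the Markov operator that differ by one step have the
    same limit, so the limit measure is invariant. *)
Lemma coding_measure_stationary : stationary_measure hP hT nu.
Proof.
apply: eq_on_borel_continuous => f cf.
have cUf := dual_continuous hT (P := P) cf.
have lim1 := markov_operator_cvg nu cUf.
have lim2 := markov_operator_cvg nu cf.
rewrite -(cvg_shiftS (fun n => \int[iter n S nu]_x (f x)%:E)%E) in lim2.
have limE : (fun n => \int[iter n.+1 S nu]_x (f x)%:E)%E =
    (fun n => \int[iter n S nu]_x (U f x)%:E)%E.
  apply/funext => n; rewrite !integral_continuousE//.
  by rewrite [iter n.+1 _ _]iterS Rintegral_markov.
rewrite limE in lim2.
rewrite -(cvg_lim _ lim2)// (cvg_lim _ lim1)//.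
by rewrite !integral_continuousE// Rintegral_markov.
Qed.

(** The integrals against the iterates of a stationary measure are constant,
    hence equal to their limit. *)
Lemma stationary_measure_unique mu :
  stationary_measure hP hT mu -> eq_on_borel mu nu.
Proof.
move=> stat; apply: eq_on_borel_continuous => f cf.
have fixed n g : continuous g ->
    (\int[iter n S mu]_x (g x)%:E = \int[mu]_x (g x)%:E)%E.
  elim: n g => // n ih g cg; have cUg := dual_continuous hT (P := P) cg.
  rewrite integral_continuousE// iterS Rintegral_markov// -integral_continuousE//.
  rewrite ih// integral_continuousE// -(Rintegral_markov hP hT)// -integral_continuousE//.
  by apply: eq_measure_integral => A mA _; exact: stat.
have := markov_operator_cvg mu cf.
under eq_fun do rewrite fixed//.
by move/(cvg_lim _) => <-//; rewrite lim_cst.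
Qed.

End stability.

(* The number of maps is k.+1. *)
Theorem theorem6 (R : realType) (k : nat) (hk : (2 <= k.+1)%N)
    (T : symbol k -> unit_interval R -> unit_interval R)
    (hT : forall i, continuous (T i))
    (P : 'M[R]_k.+1) (hP : transition_matrix P)
    (hirr : irreducible_matrix P)
    (Qplus Qminus : probability (borel (shift_space k)) R)
    (hQplus : markov_measure P Qplus)
    (hQminus : inverse_markov_measure Qplus Qminus)
    (hmix : mixing Qminus)
    (J : set (unit_interval R)) (hJ : closed_subinterval J)
    (hsplit : splits_in T Qminus J) :
  asymptotically_stable hP hT /\
  exists nu : probability (borel (ext_space R k)) R,
    [/\ ext_coding_image T Qminus nu,
        stationary_measure hP hT nu &
        forall mu, stationary_measure hP hT mu -> eq_on_borel mu nu].
Proof.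
have [p hp hQ] := inverse_markov_mass hQplus hQminus.
have p_gt0 := stationary_gt0 hP hirr hp.
have diam0 d : 0 < d -> diam_mass T P p d n @[n --> \oo] --> 0.
  by move=> d0; apply: diam_mass_cvg0 => //; exact: splitting_hits hsplit.
have Q_hyperbolic := weakly_hyperbolic_ae hQ diam0.
split; exists (coding_measure T Qminus).
- exact: coding_measure_stationary hQ Q_hyperbolic p_gt0 diam0 hmix.
- exact: markov_operator_cvg hQ Q_hyperbolic p_gt0 diam0 hmix.
split.
- exact: coding_measure_image.
- exact: coding_measure_stationary hQ Q_hyperbolic p_gt0 diam0 hmix.
- exact: stationary_measure_unique hQ Q_hyperbolic p_gt0 diam0 hmix.
Qed.
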